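(* Let $M$ be a PTR-submanifold of a Sasakian manifold with totally real distribution $\mathcal D^\perp$ and ambiguous distribution $\widetilde{\mathcal D}$. For $X,Y\in\Gamma(\widetilde{\mathcal D})$ define $$\mathcal Q(X,Y)=h(X,PY)-h(Y,PX)+\nabla_X^\perp FY-\nabla_Y^\perp FX.$$ Then $\widetilde{\mathcal D}$ is integrable if and only if, for all $X,Y\in\Gamma(\widetilde{\mathcal D})$, $$g(\mathcal Q(X,Y),\phi Z)=0\ \text{ for all } Z\in\Gamma(\mathcal D^{\perp}),\qquad\text{and}\qquad g(PX,Y)=0.$$
   Context: A Sasakian manifold $(\overline M^{2m+1},\phi,\xi,\eta,g)$ consists of a Riemannian metric $g$ with Levi-Civita connection $\widetilde\nabla$, a $(1,1)$-tensor field $\phi$, a vector field $\xi$ (the Reeb field) and a 1-form $\eta$ with $\phi^2X=-X+\eta(X)\xi$, $\eta(\xi)=1$, $\phi\xi=0$, $g(\phi X,\phi Y)=g(X,Y)-\eta(X)\eta(Y)$ and $(\widetilde\nabla_X\phi)Y=g(X,Y)\xi-\eta(Y)X$; in particular $\widetilde\nabla_X\xi=-\phi X$. Let $M$ be an immersed submanifold with $\xi\in\Gamma(TM)$, with second fundamental form $h$ and normal connection $\nabla^\perp$. For $X\in TM$ write $\phi X=PX+FX$ with $PX$ tangent and $FX$ normal. A PTR (partially totally real) submanifold is such an $M$ with a chosen nonzero constant-rank distribution $\mathcal D^{\perp}\subset TM\cap\ker\eta$ satisfying $\phi\mathcal D^{\perp}\subset T^{\perp}M$. The ambiguous distribution $\widetilde{\mathcal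 D}$ is the orthogonal complement of $\mathcal D^{\perp}\oplus\langle\xi\rangle$ in $TM$. *)

(* Defs.v *)
From HB Require Import structures.
From mathcomp Require Import all_boot all_order all_algebra.
From mathcomp Require Import all_classical all_reals all_analysis.

Set Implicit Arguments.
Unset Strict Implicit.
Unset Printing Implicit Defensive.

Import Order.TTheory GRing.Theory Num.Theory.
Import numFieldNormedType.Exports.

Local Open Scope classical_set_scope.
Local Open Scope ring_scope.

(* C^k and C^oo on an open subset U of R^n. *)
Fixpoint Ck (R : realType) (n : nat) (V : normedModType R) (k : nat)
    (U : set 'rV[R]_n) (f : 'rV[R]_n -> V) : Prop :=
  match k with
  | 0%N => forall x, U x -> {for x, continuous f}
  | k'.+1 => (forall x, U x -> differentiable f x) /\
             (forall v : 'rV[R]_n, Ck k' U (fun x => 'd f x v))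
  end.

Definition smooth (R : realType) (n : nat) (V : normedModType R)
    (U : set 'rV[R]_n) (f : 'rV[R]_n -> V) : Prop :=
  forall k, Ck k U f.

(* The values of [cmap] outside [cdom], and of [cinv] outside the image
   [cmap @` cdom], carry no meaning. *)
Record chart (R : realType) (n : nat) (T : topologicalType) := Chart {
  cdom : set T;
  cmap : T -> 'rV[R]_n;
  cinv : 'rV[R]_n -> T;
  cdom_open : open cdom;
  cimg_open : open (cmap @` cdom);
  cmapK : forall p, cdom p -> cinv (cmap p) = p;
  cmap_continuous : forall p, cdom p -> {for p, continuous cmap};
  cinv_continuous : forall x, (cmap @` cdom) x -> {for x, continuous cinv}
}.

(* A smooth manifold is given by any smooth atlas, not necessarily maximal.
   As in Lean's Mathlib, [chart_at p] is an arbitrarily chosen chart of the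
   atlas around p, and the tangent space T_p M is identified with R^n by means
   of it: a tangent vector at p *is* its row of components in [chart_at p]. *)
Record manifold (R : realType) (n : nat) := Manifold {
  carrier :> topologicalType;
  mfd_hausdorff : hausdorff_space carrier;
  mfd_second_countable : @second_countable carrier;
  atlas : set (chart R n carrier);
  chart_at : carrier -> chart R n carrier;
  chart_at_atlas : forall p, atlas (chart_at p);
  chart_at_dom : forall p, cdom (chart_at p) p;
  atlas_compat : forall c d, atlas c -> atlas d ->
    smooth (cmap c @` (cdom c `&` cdom d)) (cmap d \o cinv c)
}.

(* In a point-dependent expression, a vector attached to p : M is an element
   of T_p M, hence refers to the chart [chart_at p]. *)
Definition vfield (R : realType) (n : nat) (M : manifold R n) :=
  M -> 'rV[R]_n.

(* The derivative at p, along the tangent vector u at p, of a function with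
   values in a normed space. *)
Definition dfun (R : realType) (n : nat) (M : manifold R n)
    (V : normedModType R) (p : M) (f : M -> V) (u : 'rV[R]_n) : V :=
  'd (f \o cinv (chart_at p)) (cmap (chart_at p) p) u.

(* The components in the chart c of the tangent vector u at p. *)
Definition coord (R : realType) (n : nat) (M : manifold R n)
    (c : chart R n M) (p : M) (u : 'rV[R]_n) : 'rV[R]_n :=
  dfun p (cmap c) u.

(* The coordinate vector field d/dx^i of the chart c. *)
Definition frame (R : realType) (n : nat) (M : manifold R n)
    (c : chart R n M) (i : 'I_n) : vfield M :=
  fun p => 'd (cmap (chart_at p) \o cinv c) (cmap c p) (delta_mx 0 i).

Definition smooth_fun (R : realType) (n : nat) (M : manifold R n)
    (V : normedModType R) (U : set M) (f : M -> V) : Prop :=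
  forall c, atlas c -> smooth (cmap c @` (cdom c `&` U)) (f \o cinv c).

Definition smooth_map (R : realType) (k n : nat) (M : manifold R k)
    (N : manifold R n) (F : M -> N) : Prop :=
  continuous F /\
  forall c d, atlas c -> atlas d ->
    smooth (cmap c @` (cdom c `&` F @^-1` cdom d)) (cmap d \o F \o cinv c).

(* The differential T_p M -> T_(F p) N. *)
Definition dmap (R : realType) (k n : nat) (M : manifold R k)
    (N : manifold R n) (F : M -> N) (p : M) (u : 'rV[R]_k) : 'rV[R]_n :=
  dfun p (cmap (chart_at (F p)) \o F) u.

Definition immersion (R : realType) (k n : nat) (M : manifold R k)
    (N : manifold R n) (F : M -> N) : Prop :=
  smooth_map F /\ forall p, injective (dmap F p).

(* A vector field along F assigns to p : M a vector of T_(F p) N. *)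
Definition smooth_along (R : realType) (k n : nat) (M : manifold R k)
    (N : manifold R n) (F : M -> N) (U : set M) (V : M -> 'rV[R]_n) : Prop :=
  forall c d, atlas c -> atlas d ->
    smooth (cmap c @` (cdom c `&` U `&` F @^-1` cdom d))
           ((fun p => coord d (F p) (V p)) \o cinv c).

Definition smooth_field (R : realType) (n : nat) (M : manifold R n)
    (U : set M) (X : vfield M) : Prop :=
  smooth_along (fun p : M => p) U X.

(* [X, Y] = (X^i d_i Y^j - Y^i d_i X^j) d_j in the chart [chart_at p]. *)
Definition bracket (R : realType) (n : nat) (M : manifold R n)
    (X Y : vfield M) : vfield M :=
  fun p => dfun p (fun q => coord (chart_at p) q (Y q)) (X p)
         - dfun p (fun q => coord (chart_at p) q (X q)) (Y p).

Record metric (R : realType) (n : nat) (M : manifold R n) := Metric {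
  metric_val :> M -> 'rV[R]_n -> 'rV[R]_n -> R;
  metric_linear : forall p u, scalar (metric_val p u);
  metric_sym : forall p u v, metric_val p u v = metric_val p v u;
  metric_pos : forall p u, u != 0 -> 0 < metric_val p u u;
  metric_smooth : forall (U : set M) (X Y : vfield M), open U ->
    smooth_field U X -> smooth_field U Y ->
    smooth_fun U (fun p => metric_val p (X p) (Y p) : R^o)
}.

(* [D p u Y] is the covariant derivative at p of Y along u in T_p M, so that
   (nabla_X Y)(p) is [D p (X p) Y].  The axioms only concern fields that are
   smooth around the point; taking for f in [connection_leibniz] the indicator
   function of a neighbourhood shows that D is local in Y. *)
Record connection (R : realType) (n : nat) (M : manifold R n) := Connection {
  cov :> M -> 'rV[R]_n -> vfield M -> 'rV[R]_n;
  connection_linear : forall (U : set M) (Y : vfield M) p, open U ->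
    smooth_field U Y -> U p -> linear (fun u => cov p u Y);
  connection_add : forall (U : set M) (Y Z : vfield M) p u, open U ->
    smooth_field U Y -> smooth_field U Z -> U p ->
    cov p u (fun q => Y q + Z q) = cov p u Y + cov p u Z;
  connection_leibniz : forall (U : set M) (f : M -> R^o) (Y : vfield M) p u,
    open U -> smooth_fun U f -> smooth_field U Y -> U p ->
    cov p u (fun q => f q *: Y q) = dfun p f u *: Y p + f p *: cov p u Y;
  connection_smooth : forall (U : set M) (X Y : vfield M), open U ->
    smooth_field U X -> smooth_field U Y ->
    smooth_field U (fun p => cov p (X p) Y)
}.

Definition levi_civita (R : realType) (n : nat) (M : manifold R n)
    (g : metric M) (D : connection M) : Prop :=
  (forall (U : set M) (X Y : vfield M) p, open U ->
    smooth_field U X -> smooth_field U Y -> U p ->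
    D p (X p) Y - D p (Y p) X = bracket X Y p) /\
  (forall (U : set M) (Y Z : vfield M) p u, open U ->
    smooth_field U Y -> smooth_field U Z -> U p ->
    dfun p (fun q => g q (Y q) (Z q) : R^o) u
    = g p (D p u Y) (Z p) + g p (Y p) (D p u Z)).

Record sasakian (R : realType) (m : nat) (N : manifold R m.*2.+1) := Sasakian {
  sg : metric N;
  snabla : connection N;
  sphi : N -> 'rV[R]_(m.*2.+1) -> 'rV[R]_(m.*2.+1);
  sxi : vfield N;
  seta : N -> 'rV[R]_(m.*2.+1) -> R;
  snabla_levi_civita : levi_civita sg snabla;
  sphi_linear : forall p, linear (sphi p);
  sphi_smooth : forall (U : set N) (X : vfield N), open U ->
    smooth_field U X -> smooth_field U (fun p => sphi p (X p));
  sxi_smooth : smooth_field setT sxi;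
  seta_linear : forall p, scalar (seta p);
  seta_smooth : forall (U : set N) (X : vfield N), open U ->
    smooth_field U X -> smooth_fun U (fun p => seta p (X p) : R^o);
  sphi_sqr : forall p u, sphi p (sphi p u) = - u + seta p u *: sxi p;
  seta_xi : forall p, seta p (sxi p) = 1;
  sphi_xi : forall p, sphi p (sxi p) = 0;
  sg_phi : forall p u v,
    sg p (sphi p u) (sphi p v) = sg p u v - seta p u * seta p v;
  (* (nabla_u phi) Y = nabla_u (phi Y) - phi (nabla_u Y) *)
  snabla_phi : forall (U : set N) (Y : vfield N) p u, open U ->
    smooth_field U Y -> U p ->
    snabla p u (fun q => sphi q (Y q)) - sphi p (snabla p u Y)
    = sg p u (Y p) *: sxi p - seta p (Y p) *: u
}.

(* The derivative at p along u in T_p M of a vector field V along F, for the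
   pull-back of the connection D by F: writing V = V^i (d_i o F) around p,
   it is u(V^i) d_i + V^i D_(dF u) d_i. *)
Definition cov_along (R : realType) (k n : nat) (M : manifold R k)
    (N : manifold R n) (D : connection N) (F : M -> N)
    (p : M) (u : 'rV[R]_k) (V : M -> 'rV[R]_n) : 'rV[R]_n :=
  let c := chart_at (F p) in
  let Vc := fun q => coord c (F q) (V q) in
  \sum_(i < n) ((dfun p Vc u) 0 i *: frame c i (F p)
                + (Vc p) 0 i *: D (F p) (dmap F p u) (frame c i)).

Definition distribution (R : realType) (k : nat) (M : manifold R k) :=
  M -> set 'rV[R]_k.

Definition section (R : realType) (k : nat) (M : manifold R k)
    (E : distribution M) (X : vfield M) : Prop :=
  smooth_field setT X /\ forall p, E p (X p).

(* Integrability in the sense of Spivak and Warner: the sections are closed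
   under the Lie bracket. *)
Definition integrable_distribution (R : realType) (k : nat) (M : manifold R k)
    (E : distribution M) : Prop :=
  forall X Y : vfield M, section E X -> section E Y -> section E (bracket X Y).

(* [ptr_xi] is the Reeb field xi seen as a vector field of the submanifold. *)
Record ptr_submanifold (R : realType) (m k : nat) (N : manifold R m.*2.+1)
    (S : sasakian N) (M : manifold R k) := PTRSubmanifold {
  ptr_map :> M -> N;
  ptr_xi : vfield M;
  ptr_D : M -> {vspace 'rV[R]_k};
  ptr_rank : nat;
  ptr_immersion : immersion ptr_map;
  ptr_xi_smooth : smooth_field setT ptr_xi;
  ptr_xiE : forall p, dmap ptr_map p (ptr_xi p) = sxi S (ptr_map p);
  ptr_rank_gt0 : (0 < ptr_rank)%N;
  ptr_dim : forall p, \dim (ptr_D p) = ptr_rank;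
  ptr_D_smooth : forall p, exists (U : set M) (E : 'I_ptr_rank -> vfield M),
    [/\ open U, U p, forall i, smooth_field U (E i) &
        forall q, U q -> ptr_D q = <<[seq E i q | i : 'I_ptr_rank]>>%VS];
  ptr_D_eta : forall p u, u \in ptr_D p ->
    seta S (ptr_map p) (dmap ptr_map p u) = 0;
  ptr_D_phi : forall p u v, u \in ptr_D p ->
    sg S (ptr_map p) (sphi S (ptr_map p) (dmap ptr_map p u))
                     (dmap ptr_map p v) = 0
}.

Definition totally_real (R : realType) (m k : nat) (N : manifold R m.*2.+1)
    (S : sasakian N) (M : manifold R k) (i : ptr_submanifold S M) :
    distribution M := fun p => [set` ptr_D i p].

Definition ambiguous (R : realType) (m k : nat) (N : manifold R m.*2.+1)
    (S : sasakian N) (M : manifold R k) (i : ptr_submanifold S M) :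
    distribution M :=
  fun p => [set u | forall v, v \in (ptr_D i p + <[ptr_xi i p]>)%VS ->
                    sg S (i p) (dmap i p u) (dmap i p v) = 0].

Definition push (R : realType) (m k : nat) (N : manifold R m.*2.+1)
    (S : sasakian N) (M : manifold R k) (i : ptr_submanifold S M)
    (X : vfield M) : M -> 'rV[R]_(m.*2.+1) :=
  fun p => dmap i p (X p).

(* The orthogonal decomposition w = di(tangent_part i p w) + normal_part i p w
   of w in T_(i p) N: [tangent_part i p w] is the unique u in T_p M such that
   w - di(u) is normal. *)
Definition tangent_part (R : realType) (m k : nat) (N : manifold R m.*2.+1)
    (S : sasakian N) (M : manifold R k) (i : ptr_submanifold S M)
    (p : M) (w : 'rV[R]_(m.*2.+1)) : 'rV[R]_k :=
  xget 0 [set u | forall v, sg S (i p) (w - dmap i p u) (dmap i p v) = 0].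

Definition normal_part (R : realType) (m k : nat) (N : manifold R m.*2.+1)
    (S : sasakian N) (M : manifold R k) (i : ptr_submanifold S M)
    (p : M) (w : 'rV[R]_(m.*2.+1)) : 'rV[R]_(m.*2.+1) :=
  w - dmap i p (tangent_part i p w).

Definition second_form (R : realType) (m k : nat) (N : manifold R m.*2.+1)
    (S : sasakian N) (M : manifold R k) (i : ptr_submanifold S M)
    (X Y : vfield M) : M -> 'rV[R]_(m.*2.+1) :=
  fun p => normal_part i p (cov_along (snabla S) i p (X p) (push i Y)).

Definition normal_cov (R : realType) (m k : nat) (N : manifold R m.*2.+1)
    (S : sasakian N) (M : manifold R k) (i : ptr_submanifold S M)
    (X : vfield M) (V : M -> 'rV[R]_(m.*2.+1)) :
    M -> 'rV[R]_(m.*2.+1) :=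
  fun p => normal_part i p (cov_along (snabla S) i p (X p) V).

Definition phi_tan (R : realType) (m k : nat) (N : manifold R m.*2.+1)
    (S : sasakian N) (M : manifold R k) (i : ptr_submanifold S M)
    (X : vfield M) : vfield M :=
  fun p => tangent_part i p (sphi S (i p) (push i X p)).

Definition phi_nor (R : realType) (m k : nat) (N : manifold R m.*2.+1)
    (S : sasakian N) (M : manifold R k) (i : ptr_submanifold S M)
    (X : vfield M) : M -> 'rV[R]_(m.*2.+1) :=
  fun p => normal_part i p (sphi S (i p) (push i X p)).

Definition Qtensor (R : realType) (m k : nat) (N : manifold R m.*2.+1)
    (S : sasakian N) (M : manifold R k) (i : ptr_submanifold S M)
    (X Y : vfield M) : M -> 'rV[R]_(m.*2.+1) :=
  fun p => second_form i X (phi_tan i Y) p - second_form i Y (phi_tan i X) p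
         + normal_cov i X (phi_nor i Y) p - normal_cov i Y (phi_nor i X) p.

(* Main.v *)
From HB Require Import structures.
From mathcomp Require Import all_boot all_order all_algebra.
From mathcomp Require Import all_classical all_reals all_analysis.
From mathcomp Require Import ring.
Require Import Defs.

Set Implicit Arguments.
Unset Strict Implicit.
Unset Printing Implicit Defensive.
Import Order.TTheory GRing.Theory Num.Theory.
Import numFieldNormedType.Exports.

Local Open Scope classical_set_scope.
Local Open Scope ring_scope.

(** Write [nab] for the ambient connection pulled back to the submanifold and
    [di] for the differential of the immersion.  For two sections [X], [Y] of
    the ambiguous distribution, the part of the bracket [[X, Y]] that could
    leave the distribution has a component along the Reeb field [xi] and one
    along the totally real distribution.  The two conditions of the theorem say,
    one each, that these components vanish.

    - Reeb component.  As [eta Y = 0], one has [phi (phi Y) = - Y].  Applying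
      twice the equation
      [nab_X (phi V) = phi (nab_X V) + g(X, V) xi - eta(V) X] ([cov_along_phi])
      and taking [eta] gives [eta (nab_X Y) = g(phi X, Y)].  As [nab] has no
      torsion ([cov_along_torsion]) and [phi] is skew, [eta (di [X, Y])] is
      [2 g(phi X, Y) = 2 g(P X, Y)] ([eta_bracket]).

    - Totally real component.  Let [Z] be a section of the totally real
      distribution.  As [phi Z] is normal, it does not see the tangential parts
      that [h] and the normal connection discard.  The terms in [P Y] and [F Y]
      therefore recombine into [nab_X (phi Y)], and [g(Q(X, Y), phi Z)] is
      [g(phi (di [X, Y]), phi Z) = g(di [X, Y], di Z)] ([metric_Qtensor]).

    The tensorial computations rest on some analysis.  Absence of torsion along
    a map, like smoothness of the bracket, comes from the symmetry of second
    derivatives ([diff_diff_sym]), through the naturality of the bracket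
    ([dfun_bracket]).  Splitting [nab_X (phi Y)] into its [P Y] and [F Y] terms
    requires that the tangential part of a differentiable field be
    differentiable, which follows from Cramer's rule for the Gram matrix
    ([along_diff_tangent]).  Finally, the condition on [Q] speaks of global
    sections [Z] only, so that every vector of the totally real distribution has
    to be extended to a global section, by means of a smooth bump function
    ([section_through]). *)

(** * Differentials and maps of class C^k *)

(** Differentiability and the differential at [x] depend only on the germ at
    [x]; most computations below replace a function by a local expression. *)
Lemma near_eq_is_diff (R : realType) (V W : normedModType R) (f g : V -> W)
    (df : V -> W) (x : V) :
  (\forall y \near x, f y = g y) -> is_diff x f df -> is_diff x g df.
Proof.
move=> fg dfx.
have df_ : differentiable f x by apply: ex_diff.
have <- : 'd f x = df :> (_ -> _) by apply: diff_val.
have H : continuous ('d f x) /\ g \o shift x = cst (g x) + 'd f x +o_ 0 id.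
  split; first exact: diff_continuous.
  apply/eqaddoP => e e0.
  have /diff_locallyP[_ /eqaddoP/(_ e e0) fe] := df_.
  have fg0 : \forall h \near (0 : V), f (h + x) = g (h + x).
    by move: fg; rewrite (near_shift 0) /=; apply: filterS => h; rewrite subr0.
  near=> h.
  have -> : (g \o shift x - (cst (g x) + 'd f x)) h
          = (f \o shift x - (cst (f x) + 'd f x)) h.
    rewrite !fctE /= (nbhs_singleton fg); congr (_ - _); apply/esym.
    by near: h.
  by near: h.
have dgE := diff_unique H.1 H.2.
by apply: DiffDef => //; apply/diff_locallyP; rewrite dgE.
Unshelve. all: by end_near. Qed.

Lemma is_diff_apply (R : realType) (V W : normedModType R) (f df : V -> W)
    (x v : V) : is_diff x f df -> 'd f x v = df v.
Proof. by move=> [_ /(congr1 (@^~ v))]. Qed.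

Lemma near_eq_diff (R : realType) (V W : normedModType R) (f g : V -> W) x v :
  (\forall y \near x, f y = g y) -> differentiable f x ->
  'd f x v = 'd g x v.
Proof.
move=> fg /differentiableP dfx.
exact/esym/(is_diff_apply v (near_eq_is_diff fg dfx)).
Qed.

Lemma near_eq_differentiable (R : realType) (V W : normedModType R)
    (f g : V -> W) x :
  (\forall y \near x, f y = g y) -> differentiable f x -> differentiable g x.
Proof.
by move=> fg /differentiableP dfx; have [] := near_eq_is_diff fg dfx.
Qed.

Lemma scale_is_bilinear (R : realType) (V : normedModType R) :
  bilinear_for
    (GRing.Scale.Law.clone _ _ *:%R _) (GRing.Scale.Law.clone _ _ *:%R _)
    (@GRing.scale R V : R^o -> V -> V).
Proof.
split=> [u'|u] a x y /=.
- by rewrite scalerDl scalerA.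
- by rewrite scalerDr !scalerA mulrC.
Qed.

Lemma is_diff_scale (R : realType) (U V : normedModType R) (a da : U -> R^o)
    (f df : U -> V) x :
  is_diff x a da -> is_diff x f df ->
  is_diff x (fun y => a y *: f y) (fun v => a x *: df v + da v *: f x).
Proof.
move=> dax dfx.
pose bM := bilinear_isBilinear.Build R R^o V V _ _ (@GRing.scale R V)
  (@scale_is_bilinear R V).
pose b : {bilinear R^o -> V -> V} := HB.pack (@GRing.scale R V : R^o -> V -> V) bM.
have bc : continuous (fun p : R^o * V => b p.1 p.2) by move=> p; exact: scale_continuous.
have db : is_diff (a x, f x) (fun p : R^o * V => b p.1 p.2)
   (fun q => b (a x) q.2 + b q.1 (f x)).
  by apply: DiffDef; [exact: differentiable_bilin | rewrite diff_bilin].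
have := is_diff_comp (is_diff_pair dax dfx) db.
by [].
Qed.

Lemma is_diff_sum (R : realType) (U V : normedModType R) (I : Type) (r : seq I)
    (f df : I -> U -> V) x :
  (forall i, is_diff x (f i) (df i)) ->
  is_diff x (fun y => \sum_(i <- r) f i y) (fun v => \sum_(i <- r) df i v).
Proof.
move=> dfx; elim: r => [|i r IH].
  under eq_fun do rewrite big_nil; under [X in is_diff _ _ X]eq_fun do rewrite big_nil.
  exact: is_diff_cst.
under eq_fun do rewrite big_cons; under [X in is_diff _ _ X]eq_fun do rewrite big_cons.
exact: is_diffD.
Qed.

Lemma differentiable_bigsum (R : realType) (U V : normedModType R) (I : Type)
    (r : seq I) (f : I -> U -> V) x :
  (forall i, differentiable (f i) x) ->
  differentiable (fun y => \sum_(i <- r) f i y) x.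
Proof.
move=> df.
have dfx i : is_diff x (f i) ('d (f i) x) by exact/differentiableP.
by have [] := is_diff_sum r dfx.
Qed.

Section rV.
Context {R : realType}.
Implicit Types (V W : normedModType R).

Lemma linear_rV_continuous n V (f : {linear 'rV[R]_n -> V}) : continuous f.
Proof.
have -> : f = (fun u => \sum_(j < n) u 0 j *: f (delta_mx 0 j)) :> (_ -> _).
  apply/funext => u; rewrite [in LHS](row_sum_delta u) linear_sum.
  by apply: eq_bigr => j _; rewrite linearZ.
move=> x; apply: differentiable_continuous.
apply: differentiable_bigsum => j.
by apply: differentiableZl; exact: differentiable_coord.
Qed.

Lemma is_diff_linear_rV n V (f : {linear 'rV[R]_n -> V}) x : is_diff x f f.
Proof.
apply: DiffDef; first by apply/linear_differentiable/linear_rV_continuous.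
by rewrite diff_lin //; exact: linear_rV_continuous.
Qed.

Lemma linear_deltaE n V (f : {linear 'rV[R]_n -> V}) u :
  f u = \sum_(j < n) u 0 j *: f (delta_mx 0 j).
Proof.
rewrite [in LHS](row_sum_delta u) linear_sum.
by apply: eq_bigr => j _; rewrite linearZ.
Qed.

Lemma is_diff_entry n (j : 'I_n) (x : 'rV[R]_n) :
  is_diff x (fun u : 'rV[R]_n => u 0 j : R^o) (fun u => u 0 j).
Proof.
have l : linear (fun u : 'rV[R]_n => u 0 j : R^o) by move=> a u v; rewrite !mxE.
pose lM := GRing.isLinear.Build _ _ _ _ _ l.
pose L : {linear 'rV[R]_n -> R^o} := HB.pack (fun u : 'rV[R]_n => u 0 j : R^o) lM.
exact: (is_diff_linear_rV L).
Qed.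

Lemma diff_entry V n (f : V -> 'rV[R]_n) x (j : 'I_n) :
  differentiable f x ->
  is_diff x (fun y => f y 0 j : R^o) (fun v => 'd f x v 0 j).
Proof.
move=> /differentiableP df.
exact: (@is_diff_comp _ _ _ _ f _ (fun u : 'rV[R]_n => u 0 j : R^o) _ x df
  (is_diff_entry j (f x))).
Qed.

Section Ck.
Context {n : nat}.
Implicit Types (U : set 'rV[R]_n).

Lemma CkS V k U (f : 'rV[R]_n -> V) : Ck k.+1 U f -> Ck k U f.
Proof.
elim: k f => [|k IH] f [df Cf].
  by move=> x Ux; apply: differentiable_continuous; exact: df.
by split => // v; apply: IH; exact: Cf.
Qed.

Lemma Ck_subset V k U U' (f : 'rV[R]_n -> V) :
  U' `<=` U -> Ck k U f -> Ck k U' f.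
Proof.
move=> UU'; elim: k f => [|k IH] f /=; first by move=> Cf x /UU'/Cf.
by move=> [df Cf]; split=> [x /UU'/df //|v]; apply: IH.
Qed.

(** Since [Ck] quantifies over the points of [U] at each order, smoothness can
    be checked point by point, hence glued from an open cover. *)
Lemma Ck_pointwise V k U (f : 'rV[R]_n -> V) :
  (forall x, U x -> Ck k [set x] f) -> Ck k U f.
Proof.
elim: k f => [|k IH] f H /=; first by move=> x Ux; apply: (H x Ux).
split=> [x Ux|v]; first by apply: (H x Ux).1.
by apply: IH => x Ux; apply: (H x Ux).2.
Qed.

Lemma Ck_eq V k U (f g : 'rV[R]_n -> V) : open U ->
  (forall x, U x -> f x = g x) -> Ck k U f -> Ck k U g.
Proof.
move=> oU; elim: k f g => [|k IH] f g fg /=.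
  move=> Cf x Ux.
  have fgx : \forall y \near x, f y = g y.
    by apply: filterS (open_nbhs_nbhs (conj oU Ux)) => y; exact: fg.
  have Cx : f @ x --> g x by rewrite -(fg _ Ux); exact: (Cf x Ux).
  exact: cvg_trans (near_eq_cvg _) Cx.
move=> [df Cf].
have fgx x : U x -> \forall y \near x, f y = g y.
  by move=> Ux; apply: filterS (open_nbhs_nbhs (conj oU Ux)) => y; exact: fg.
split=> [x Ux|v]; first exact: near_eq_differentiable (fgx _ Ux) (df _ Ux).
apply: IH (Cf v) => x Ux.
exact: near_eq_diff (fgx _ Ux) (df _ Ux).
Qed.

Lemma Ck_cst V k U (c : V) : Ck k U (fun=> c).
Proof.
elim: k c => [|k IH] c /=; first by move=> x _; exact: cst_continuous.
split=> [x _|v]; first exact: differentiable_cst.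
have -> : (fun x : 'rV_n => 'd (fun=> c) x v) = fun=> 0.
  by apply/funext => x; rewrite (diff_cst c x).
exact: IH.
Qed.

Lemma Ck_add V k U (f g : 'rV[R]_n -> V) : open U ->
  Ck k U f -> Ck k U g -> Ck k U (fun x => f x + g x).
Proof.
move=> oU; elim: k f g => [|k IH] f g /=.
  by move=> Cf Cg x Ux; apply: continuousD; [exact: Cf|exact: Cg].
move=> [df Cf] [dg Cg]; split=> [x Ux|v].
  by apply: differentiableD; [exact: df|exact: dg].
apply: Ck_eq (IH _ _ (Cf v) (Cg v)) => // x Ux.
have dfx := differentiableP (df _ Ux); have dgx := differentiableP (dg _ Ux).
exact/esym/(is_diff_apply _ (is_diffD dfx dgx)).
Qed.

Lemma Ck_sum V k U (I : Type) (r : seq I) (f : I -> 'rV[R]_n -> V) : open U ->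
  (forall i, Ck k U (f i)) -> Ck k U (fun x => \sum_(i <- r) f i x).
Proof.
move=> oU Cf; elim: r => [|i r IH].
  by under eq_fun do rewrite big_nil; exact: Ck_cst.
by under eq_fun do rewrite big_cons; exact: Ck_add.
Qed.

Lemma Ck_scale V k U (a : 'rV[R]_n -> R^o) (f : 'rV[R]_n -> V) : open U ->
  Ck k U a -> Ck k U f -> Ck k U (fun x => a x *: f x).
Proof.
move=> oU; elim: k a f => [|k IH] a f.
  by move=> Ca Cf x Ux; apply: continuousZ; [exact: Ca|exact: Cf].
move=> Ca Cf; have [[da Ca'] [df Cf']] := (Ca, Cf).
have E x : U x -> is_diff x (fun y => a y *: f y)
    (fun v => a x *: 'd f x v + 'd a x v *: f x).
  by move=> Ux; apply: is_diff_scale; apply/differentiableP; [exact: da|exact: df].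
split=> [x /E[] //|v].
apply: (@Ck_eq _ _ _ (fun x => a x *: 'd f x v + 'd a x v *: f x)) => //.
  by move=> x /E dE; rewrite (is_diff_apply _ dE).
by apply: Ck_add => //; apply: IH; [exact: CkS|exact: Cf'|exact: Ca'|exact: CkS].
Qed.

Lemma Ck_linear V k U (f : {linear 'rV[R]_n -> V}) : Ck k U f.
Proof.
case: k => [|k]; first by move=> x _; exact: linear_rV_continuous.
split=> [x _|v].
  exact: (@ex_diff _ _ _ _ _ _ _ (is_diff_linear_rV f x)).
have -> : (fun x => 'd f x v) = fun=> f v.
  by apply/funext => x; have df := is_diff_linear_rV f x; rewrite diff_val.
exact: Ck_cst.
Qed.

End Ck.

Lemma Ck_comp_linear n m V k (U : set 'rV[R]_n) (L : {linear 'rV[R]_m -> V})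
    (h : 'rV[R]_n -> 'rV[R]_m) : open U ->
  Ck k U h -> Ck k U (fun x => L (h x)).
Proof.
move=> oU; elim: k h => [|k IH] h Ch.
  by move=> x Ux; apply: continuous_comp; [exact: Ch|exact: linear_rV_continuous].
have [dh Ch'] := Ch.
have E x : U x -> is_diff x (fun x => L (h x)) (fun v => L ('d h x v)).
  move=> Ux; have dhx := differentiableP (dh _ Ux).
  exact: is_diff_comp dhx (is_diff_linear_rV L (h x)).
split=> [x /E[] //|w].
apply: (@Ck_eq _ _ _ _ (fun x => L ('d h x w))) => //.
  by move=> x /E dE; rewrite (is_diff_apply _ dE).
exact/IH/Ch'.
Qed.

Lemma Ck_entry n m k (U : set 'rV[R]_n) (h : 'rV[R]_n -> 'rV[R]_m) j : open U ->
  Ck k U h -> Ck k U (fun x => h x 0 j : R^o).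
Proof.
have l : linear (fun u : 'rV[R]_m => u 0 j : R^o) by move=> a u w; rewrite !mxE.
pose lM := GRing.isLinear.Build _ _ _ _ _ l.
pose L : {linear 'rV[R]_m -> R^o} := HB.pack (fun u : 'rV[R]_m => u 0 j : R^o) lM.
by move=> oU; exact: (Ck_comp_linear L oU).
Qed.

(** By the chain rule, a derivative of the composite is a combination of the
    partial derivatives of [g] composed with [f], of one order less: whence an
    induction on the order for all [g] at once. *)
Lemma Ck_comp n m V k (U : set 'rV[R]_n) (U' : set 'rV[R]_m)
    (f : 'rV[R]_n -> 'rV[R]_m) (g : 'rV[R]_m -> V) : open U ->
  (forall x, U x -> U' (f x)) -> Ck k U f -> Ck k U' g ->
  Ck k U (fun x => g (f x)).
Proof.
move=> oU fU; elim: k f g fU => [|k IH] f g fU.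
  by move=> Cf Cg x Ux; apply: continuous_comp; [exact: Cf|exact/Cg/fU].
move=> Cf Cg; have [[df Cf'] [dg Cg']] := (Cf, Cg).
split=> [x Ux|v].
  by apply: differentiable_comp; [exact: df|exact/dg/fU].
apply: (@Ck_eq _ _ _ _ (fun x =>
    \sum_(j < m) ('d f x v) 0 j *: 'd g (f x) (delta_mx 0 j))) => //.
  move=> x Ux; rewrite (diff_comp (df _ Ux) (dg _ (fU _ Ux))) /=.
  by rewrite -linear_deltaE.
apply: Ck_sum => // j; apply: Ck_scale => //; first exact/Ck_entry/Cf'.
by apply: (IH f (fun y => 'd g y (delta_mx 0 j)) fU); [exact: CkS|exact: Cg'].
Qed.

End rV.

Section Smooth.
Context {R : realType}.
Implicit Types (V W : normedModType R).

Lemma smooth_differentiable n V (U : set 'rV[R]_n) (f : 'rV[R]_n -> V) x :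
  smooth U f -> U x -> differentiable f x.
Proof. by move=> sf Ux; have [df _] := sf 1%N; exact: df. Qed.

Lemma smooth_diff n V (U : set 'rV[R]_n) (f : 'rV[R]_n -> V) v :
  smooth U f -> smooth U (fun x => 'd f x v).
Proof. by move=> sf k; have [_ df] := sf k.+1; exact: df. Qed.

Lemma smooth_subset n V (U U' : set 'rV[R]_n) (f : 'rV[R]_n -> V) :
  U' `<=` U -> smooth U f -> smooth U' f.
Proof. by move=> UU' sf k; exact: Ck_subset (sf k). Qed.

Lemma smooth_pointwise n V (U : set 'rV[R]_n) (f : 'rV[R]_n -> V) :
  (forall x, U x -> smooth [set x] f) -> smooth U f.
Proof. by move=> sf k; apply: Ck_pointwise => x Ux; exact: sf. Qed.

Lemma smooth_eq n V (U : set 'rV[R]_n) (f g : 'rV[R]_n -> V) : open U ->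
  (forall x, U x -> f x = g x) -> smooth U f -> smooth U g.
Proof. by move=> oU fg sf k; exact: Ck_eq (sf k). Qed.

Lemma smooth_cst n V (U : set 'rV[R]_n) (c : V) : smooth U (fun=> c).
Proof. by move=> k; exact: Ck_cst. Qed.

Lemma smooth_add n V (U : set 'rV[R]_n) (f g : 'rV[R]_n -> V) : open U ->
  smooth U f -> smooth U g -> smooth U (fun x => f x + g x).
Proof. by move=> oU sf sg k; exact: Ck_add. Qed.

Lemma smooth_scale n V (U : set 'rV[R]_n) (a : 'rV[R]_n -> R^o)
    (f : 'rV[R]_n -> V) : open U ->
  smooth U a -> smooth U f -> smooth U (fun x => a x *: f x).
Proof. by move=> oU sa sf k; exact: Ck_scale. Qed.

Lemma smooth_sum n V (U : set 'rV[R]_n) (I : Type) (r : seq I)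
    (f : I -> 'rV[R]_n -> V) : open U ->
  (forall i, smooth U (f i)) -> smooth U (fun x => \sum_(i <- r) f i x).
Proof. by move=> oU sf k; apply: Ck_sum => // i; exact: sf. Qed.

Lemma smooth_comp n m V (U : set 'rV[R]_n) (U' : set 'rV[R]_m)
    (f : 'rV[R]_n -> 'rV[R]_m) (g : 'rV[R]_m -> V) : open U ->
  (forall x, U x -> U' (f x)) -> smooth U f -> smooth U' g ->
  smooth U (fun x => g (f x)).
Proof. by move=> oU fU sf sg k; exact: Ck_comp (sg k). Qed.

Lemma smooth_entry n m (U : set 'rV[R]_n) (f : 'rV[R]_n -> 'rV[R]_m) j :
  open U -> smooth U f -> smooth U (fun x => f x 0 j : R^o).
Proof. by move=> oU sf k; exact: Ck_entry. Qed.

Lemma smooth_diff_field n V (U : set 'rV[R]_n) (f : 'rV[R]_n -> V)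
    (w : 'rV[R]_n -> 'rV[R]_n) : open U ->
  smooth U f -> smooth U w -> smooth U (fun x => 'd f x (w x)).
Proof.
move=> oU sf sw; under eq_fun do rewrite linear_deltaE.
apply: smooth_sum => // j; apply: smooth_scale => //; first exact: smooth_entry.
exact: smooth_diff.
Qed.

(** The first term is a second derivative of [f] along the fixed vector [w x];
    in this form the symmetry of second derivatives applies to it. *)
Lemma is_diff_diff_field n V (U : set 'rV[R]_n) (f : 'rV[R]_n -> V)
    (w dw : 'rV[R]_n -> 'rV[R]_n) x : U x ->
  smooth U f -> is_diff x w dw ->
  is_diff x (fun y => 'd f y (w y))
    (fun v => 'd (fun y => 'd f y (w x)) x v + 'd f x (dw v)).
Proof.
move=> Ux sf dwx.
have sj j := smooth_differentiable (smooth_diff (delta_mx 0 j) sf) Ux.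
have D j : is_diff x (fun y => (w y 0 j : R^o) *: 'd f y (delta_mx 0 j))
   (fun v => (w x 0 j : R^o) *: 'd (fun y => 'd f y (delta_mx 0 j)) x v
      + (dw v 0 j : R^o) *: 'd f x (delta_mx 0 j)).
  apply: is_diff_scale; last exact/differentiableP.
  exact: is_diff_comp dwx (is_diff_entry j (w x)).
have D1 j : is_diff x (fun y => (w x 0 j : R^o) *: 'd f y (delta_mx 0 j))
   (fun v => (w x 0 j : R^o) *: 'd (fun y => 'd f y (delta_mx 0 j)) x v).
  by apply: is_diffZ; exact/differentiableP.
have := is_diff_sum (index_enum 'I_n) D.
have -> : (fun y => \sum_(j < n) (w y 0 j : R^o) *: 'd f y (delta_mx 0 j))
    = (fun y => 'd f y (w y)) by apply/funext => y; rewrite -linear_deltaE.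
move=> E; apply: is_diff_eq E _; apply/funext => v.
rewrite big_split /= -linear_deltaE; congr (_ + _).
have := is_diff_apply v (is_diff_sum (index_enum 'I_n) D1) => <-.
by congr ('d _ x v); apply/funext => y; exact/esym/linear_deltaE.
Qed.

End Smooth.

(** * Symmetry of second derivatives *)

Section Schwarz.
Context {R : realType} {n : nat}.
Implicit Types (x u v w : 'rV[R]_n).

Lemma is_derive_line (V : normedModType R) (f : 'rV[R]_n -> V) u w (s : R) :
  differentiable f (s *: u + w) ->
  is_derive s 1 (fun t : R => f (t *: u + w)) ('d f (s *: u + w) u).
Proof.
move=> /differentiableP df.
have dl : is_diff s (fun t : R => t *: u + w) (fun t : R => t *: u + 0).
  exact: is_diffD (is_diff_scalel s u) (is_diff_cst w s).
have dc := is_diff_comp dl df.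
have dd : differentiable (fun t : R => f (t *: u + w)) s by case: dc.
apply: DeriveDef; first exact/diff_derivable.
by rewrite deriveE // (is_diff_apply _ dc) /= scale1r addr0.
Qed.

(** The mean value theorem in the direction [u] reduces the second difference
    to the increment along [h *: v] of the derivative [y |-> 'd f y u], which
    is controlled by differentiability at the single point [x]. *)
Lemma second_difference (U : set 'rV[R]_n) (f : 'rV[R]_n -> R^o) x u v (e : R) :
  open U -> U x -> smooth U f -> 0 < e ->
  \forall h \near (0 : R)^'+,
    `|f (h *: u + (x + h *: v)) - f (h *: u + x) - f (x + h *: v) + f x
      - h * (h * 'd (fun y => 'd f y u) x v)| <= e * (h * h).
Proof.
move=> oU Ux sf e0.
pose A := fun y => 'd f y u.
have dA : differentiable A x by exact: smooth_differentiable (smooth_diff u sf) Ux.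
(* On the square of side [h], displacements have norm at most [h * M]; with
   [e'] as the precision, two remainder terms add up to [e * h]. *)
pose M := `|u| + `|v| + 1.
have M0 : 0 < M by rewrite ltr_wpDl // addr_ge0.
pose e' := e / (2 * M).
have e'0 : 0 < e' by rewrite divr_gt0 // mulr_gt0.
have [r r0 rP] : exists2 r, 0 < r & forall w, `|w| < r ->
   U (w + x) /\ `|A (w + x) - (A x + 'd A x w)| <= e' * `|w|.
  have /diff_locallyP[_ /eqaddoP/(_ e' e'0) Ae] := dA.
  have Un : \forall w \near (0 : 'rV[R]_n), U (w + x).
    have : \forall y \near x, U y by exact: open_nbhs_nbhs.
    by rewrite (near_shift 0) /=; apply: filterS => h; rewrite subr0.
  have Bn : \forall w \near (0 : 'rV[R]_n), U (w + x) /\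
      `|A (w + x) - (A x + 'd A x w)| <= e' * `|w|.
    by near=> w; split; near: w.
  have [r /= r0 rP] := (nbhs_normP _ _).1 Bn.
  by exists r => // w wr; apply: rP; rewrite /= sub0r normrN.
near=> h.
have h0 : 0 < h by near: h; exact: nbhs_right_gt.
have hr : h < r / M by near: h; apply: nbhs_right_lt; rewrite divr_gt0.
have hMr : h * M < r by rewrite -ltr_pdivlMr.
have bd (c d : R) : c \in `[0, h] -> d \in `[0, h] ->
    `|c *: u + d *: v| <= h * M.
  rewrite !in_itv /= => /andP[c0 ch] /andP[d0 dh].
  apply: le_trans (ler_normD _ _) _; rewrite !normrZ (ger0_norm c0) (ger0_norm d0).
  rewrite /M !mulrDr mulr1 -[leLHS]addr0 lerD ?(ltW h0) //.
  by rewrite lerD // ler_wpM2r.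
have bd' (c d : R) : c \in `[0, h] -> d \in `[0, h] -> `|c *: u + d *: v| < r.
  by move=> cP dP; apply: le_lt_trans (bd _ _ cP dP) hMr.
have h_h : h \in `[0, h] by rewrite in_itv /= lexx ltW.
have h_0 : 0 \in `[0, h] by rewrite in_itv /= lexx ltW.
pose phi (s : R) : R^o := f (s *: u + (x + h *: v)) - f (s *: u + x).
pose dphi (s : R) : R^o := A (s *: u + (x + h *: v)) - A (s *: u + x).
have dphiE s : s \in `[0, h] -> is_derive s 1 phi (dphi s).
  move=> sP; apply: is_deriveB.
    apply: is_derive_line; apply: smooth_differentiable sf _.
    have [+ _] := rP _ (bd' _ _ sP h_h).
    by rewrite -addrA [h *: v + x]addrC.
  apply: is_derive_line; apply: smooth_differentiable sf _.
  by have [+ _] := rP _ (bd' _ _ sP h_0); rewrite scale0r addr0.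
have [c cP phiE] : exists2 c, c \in `]0, h[ & phi h - phi 0 = dphi c * (h - 0).
  have dphiE' s : s \in `]0, h[ -> is_derive s 1 phi (dphi s).
    by move=> sP; apply: dphiE; exact: subset_itv_oo_cc.
  apply: (@MVT R phi dphi 0 h h0 dphiE').
  apply: derivable_within_continuous => s sP.
  by have dp := dphiE s sP; exact: ex_derive.
have cP' : c \in `[0, h] by exact: subset_itv_oo_cc.
have [_ r1] := rP _ (bd' _ _ cP' h_h).
have [_ r2] := rP _ (bd' _ _ cP' h_0).
have E : f (h *: u + (x + h *: v)) - f (h *: u + x) - f (x + h *: v) + f x
    - h * (h * 'd A x v) = h * (dphi c - h * 'd A x v).
  rewrite mulrBr; congr (_ - _).
  rewrite [RHS]mulrC -[X in _ = _ * X]subr0 -phiE /phi scale0r !add0r.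
  by ring.
rewrite E normrM gtr0_norm // mulrCA ler_pM2l // /dphi.
have -> : A (c *: u + (x + h *: v)) - A (c *: u + x) - h * 'd A x v =
   (A (c *: u + h *: v + x) - (A x + 'd A x (c *: u + h *: v)))
   - (A (c *: u + 0 *: v + x) - (A x + 'd A x (c *: u + 0 *: v))).
  have Lw : 'd A x (c *: u + h *: v) = 'd A x (c *: u) + h * 'd A x v.
    by rewrite linearD; congr (_ + _); rewrite linearZ.
  rewrite scale0r addr0 Lw.
  have -> : c *: u + h *: v + x = c *: u + (x + h *: v).
    by rewrite -addrA [h *: v + x]addrC.
  have aux (a b p q l : R) : a - b - l = (a - (p + (q + l))) - (b - (p + q)).
    by ring.
  exact: aux.
apply: le_trans (ler_normB _ _) _.
apply: le_trans (lerD r1 r2) _.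
apply: le_trans (_ : e' * (h * M) + e' * (h * M) <= _).
  by apply: lerD; rewrite ler_pM2l //; exact: bd.
have -> : e' * (h * M) + e' * (h * M) = e * h by rewrite /e'; field; rewrite gt_eqF.
by [].
Unshelve. all: by end_near. Qed.

(** The second difference is unchanged when [u] and [v] are exchanged, and
    divided by [h * h] it tends to either mixed derivative. *)
Lemma diff_diff_sym_scalar (U : set 'rV[R]_n) (f : 'rV[R]_n -> R^o) x u v :
  open U -> U x -> smooth U f ->
  'd (fun y => 'd f y u) x v = 'd (fun y => 'd f y v) x u.
Proof.
move=> oU Ux sf; apply/eqP; rewrite -subr_eq0 -normr_le0; apply/ler_addgt0Pr => e e0.
rewrite add0r.
have e20 : 0 < e / 2 by rewrite divr_gt0.
have H1 := second_difference u v oU Ux sf e20.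
have H2 := second_difference v u oU Ux sf e20.
have [h [h0 [K1 K2]]] := filter_ex (filterI (nbhs_right_gt (0 : R)) (filterI H1 H2)).
have hh0 : 0 < h * h by exact: mulr_gt0.
rewrite -(ler_pM2r hh0) -[X in _ * X]gtr0_norm // -normrM.
rewrite [leRHS](_ : _ = e / 2 * (h * h) + e / 2 * (h * h)); last by field.
apply: le_trans (lerD K1 K2).
rewrite [leRHS]addrC; apply: le_trans (ler_normB _ _).
rewrite le_eqVlt; apply/orP; left; apply/eqP; congr (`|_|).
have -> : x + h *: u = h *: u + x by rewrite addrC.
have -> : x + h *: v = h *: v + x by rewrite addrC.
rewrite [h *: v + (h *: u + x)]addrCA.
by ring.
Qed.

Lemma diff_diff_sym m (U : set 'rV[R]_n) (f : 'rV[R]_n -> 'rV[R]_m) x u v :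
  open U -> U x -> smooth U f ->
  'd (fun y => 'd f y u) x v = 'd (fun y => 'd f y v) x u.
Proof.
move=> oU Ux sf; apply/rowP => j.
have sfj : smooth U (fun y => f y 0 j : R^o) by exact: smooth_entry.
have E w w' : 'd (fun y => 'd f y w) x w' 0 j
    = 'd (fun y => 'd (fun z => f z 0 j : R^o) y w) x w'.
  have dw := smooth_differentiable (smooth_diff w sf) Ux.
  rewrite -(is_diff_apply w' (diff_entry j dw)).
  apply: near_eq_diff; last by have [] := diff_entry j dw.
  apply: filterS (open_nbhs_nbhs (conj oU Ux)) => y Uy.
  by rewrite (is_diff_apply w (diff_entry j (smooth_differentiable sf Uy))).
by rewrite !E; exact: diff_diff_sym_scalar sfj.
Qed.

End Schwarz.

(** * A smooth bump function *)

Section Flat.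
Context {R : realType}.

(** The derivatives of [t |-> expR (- t^-1)], extended by 0 to the negative
    half-line, are combinations of these functions. *)
Definition flat (j : nat) (t : R) : R :=
  if 0 < t then t^-1 ^+ j * expR (- t^-1) else 0.

Lemma flat_ge0 j t : 0 <= flat j t.
Proof.
rewrite /flat; case: ifP => // t0.
by rewrite mulr_ge0 ?expR_ge0 // exprn_ge0 // invr_ge0 ltW.
Qed.

(** This makes [flat j] differentiable at 0: its difference quotient there is
    [flat j.+1]. *)
Lemma flatS j t : flat j t = t * flat j.+1 t.
Proof.
rewrite /flat; case: ifP => t0; last by rewrite mulr0.
by rewrite exprS !mulrA divff ?mul1r // gt_eqF.
Qed.

(** The exponential series bounds [expR t^-1] below by its term of degree
    [j.+1]. *)
Lemma flat_le j t : 0 < t -> flat j t <= j.+1`!%:R * t.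
Proof.
move=> t0; rewrite /flat t0 expRN ler_pdivrMr ?expR_gt0 //.
have s0 : 0 < t^-1 by rewrite invr_gt0.
have f0 : 0 < j.+1`!%:R :> R by rewrite ltr0n fact_gt0.
have : t^-1 ^+ j.+1 / j.+1`!%:R <= expR t^-1.
  by apply: le_trans (expR_ge1Dxn j (ltW s0)); rewrite lerDr.
rewrite ler_pdivrMr // exprS ler_pdivrMl // => h.
apply: le_trans h _; rewrite [leLHS](_ : _ = j.+1`!%:R * t * expR t^-1) //.
by ring.
Qed.

Lemma is_diff_of_is_derive (V : normedModType R) (f : R -> V) (t : R) (d : V) :
  is_derive t 1 f d -> is_diff t f (fun s => s *: d).
Proof.
move=> [df dE]; have := df => /derivable1_diffP dfx.
apply: DiffDef => //; apply/funext => s.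
rewrite -dE deriveE // -[in LHS](mulr1 s) -[s * 1]/(s *: (1 : R^o)).
exact: linearZ.
Qed.

Lemma is_derive_flat_pos j (t : R) : 0 < t ->
  is_derive t 1 (fun y => y^-1 ^+ j * expR (- y^-1))
    (t^-1 ^+ j.+2 * expR (- t^-1) - j%:R * (t^-1 ^+ j.+1 * expR (- t^-1))).
Proof.
move=> t0; have tn0 : t != 0 by rewrite gt_eqF.
have dV : is_derive t 1 (fun y : R => y^-1) (- t^-1 ^+ 2).
  apply: DeriveDef; first exact: derivableV.
  rewrite deriveV // derive_id -exprVn.
  by rewrite -[LHS]/(- t^-1 ^+ 2 * 1) mulr1.
have dN : is_derive t 1 (fun y : R => - y^-1) (t^-1 ^+ 2).
  by rewrite -[_ ^+ 2]opprK; exact: is_deriveN.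
have dE : is_derive t 1 (fun y : R => expR (- y^-1)) (t^-1 ^+ 2 * expR (- t^-1)).
  rewrite mulrC; exact: (@is_derive1_comp _ expR (fun y : R => - y^-1)).
have dX : is_derive t 1 (fun y : R => y^-1 ^+ j) (- (j%:R * t^-1 ^+ j.+1)).
  have X := is_deriveX j dV; rewrite exprfctE in X; apply: (is_derive_eq X).
  rewrite -[LHS]/(j%:R * t^-1 ^+ j.-1 * - t^-1 ^+ 2).
  by case: j {X} => [|j] /=; [rewrite !mul0r oppr0|rewrite mulrN -mulrA -exprD addn2].
apply: (is_derive_eq (is_deriveM dX dE)).
rewrite -[LHS]/(t^-1 ^+ j * (t^-1 ^+ 2 * expR (- t^-1)) +
     expR (- t^-1) * - (j%:R * t^-1 ^+ j.+1)).
by rewrite !exprS; ring.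
Qed.

Lemma is_diff_flat j (t : R) :
  is_diff t (flat j) (fun s => s *: (flat j.+2 t - j%:R * flat j.+1 t)).
Proof.
have [t0|t0|/esym->] := ltgtP 0 t.
- have fE : \forall y \near t, y^-1 ^+ j * expR (- y^-1) = flat j y.
    by near=> y; rewrite /flat ifT //; near: y; exact: lt_nbhsr.
  apply: near_eq_is_diff fE _; apply: is_diff_of_is_derive.
  by rewrite /flat t0; exact: is_derive_flat_pos.
- have fE : \forall y \near t, 0 = flat j y.
    near=> y; rewrite /flat ifF //; apply/negbTE; rewrite -leNgt ltW //.
    by near: y; exact: lt_nbhsl.
  apply: near_eq_is_diff fE _.
  rewrite /flat (lt_gtF t0) mulr0 subr0.
  apply: is_diff_eq (is_diff_cst (0 : R) t) _.
  by apply/funext => s; rewrite scaler0.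
- have E : (fun s => s *: (flat j.+2 0 - j%:R * flat j.+1 0)) = \0 :> (R -> R).
    by apply/funext => s; rewrite /flat ltxx mulr0 subr0 scaler0.
  rewrite E.
  have H : continuous (\0 : R -> R) /\
     flat j \o shift 0 = cst (flat j 0) + (\0 : {linear R -> R}) +o_ 0 id.
    split; first by move=> ?; exact: cst_continuous.
    apply/eqaddoP => e e0; near=> h.
    have hlt : h < (j.+2)`!%:R^-1 * e.
      near: h; apply: lt_nbhsl.
      by rewrite mulr_gt0 // invr_gt0 ltr0n fact_gt0.
    rewrite !fctE /= addr0 {2}/flat ltxx addr0 subr0 flatS normrM mulrC.
    apply: ler_wpM2r => //; rewrite ger0_norm ?flat_ge0 //.
    have [h0|h0] := ltP 0 h; last by rewrite /flat ltNge h0 /= ltW.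
    apply: le_trans (flat_le _ h0) _.
    rewrite -ler_pdivlMl ?ltr0n ?fact_gt0 // ltW //.
  have dE := diff_unique H.1 H.2.
  by apply: DiffDef => //; apply/diff_locallyP; rewrite dE.
Unshelve. all: by end_near. Qed.

(** The derivative of [flat j] is a combination of [flat j.+1] and [flat j.+2],
    so that the induction on the order runs over all [j] at once. *)
Lemma Ck_flat n k (U : set 'rV[R]_n) (h : 'rV[R]_n -> R^o) j :
  open U -> Ck k U h -> Ck k U (fun x => flat j (h x) : R^o).
Proof.
move=> oU; elim: k j h => [|k IH] j h Ch.
  move=> x Ux; apply: continuous_comp; first exact: Ch.
  by apply: differentiable_continuous; have [] := is_diff_flat j (h x).
have [dh Ch'] := Ch.
pose c (x : 'rV[R]_n) : R^o := flat j.+2 (h x) - j%:R * flat j.+1 (h x).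
have E x : U x -> is_diff x (fun y => flat j (h y) : R^o) (fun v => 'd h x v *: c x).
  move=> Ux; have dhx := differentiableP (dh _ Ux).
  exact: is_diff_comp dhx (is_diff_flat j (h x)).
split=> [x /E[] //|v].
apply: (@Ck_eq _ _ R^o _ _ (fun x => 'd h x v *: c x)) => //.
  by move=> x /E dE; exact/esym/(is_diff_apply v dE).
suff Cc : Ck k U c by exact: Ck_scale oU (Ch' v) Cc.
have -> : c = fun x => (flat j.+2 (h x) : R^o) + (- j%:R : R^o) *: (flat j.+1 (h x) : R^o).
  by apply/funext => x; rewrite scaleNr.
apply: (@Ck_add _ _ R^o _ _ (fun x => flat j.+2 (h x) : R^o)) => //.
  exact/IH/CkS.
apply: (@Ck_scale _ _ R^o _ _ (fun=> - j%:R) (fun x => flat j.+1 (h x) : R^o)) => //.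
  exact: Ck_cst.
exact/IH/CkS.
Qed.

(** A smooth bump function centred at [x0], supported in the closed ball of
    radius [r] for the sup norm. *)
Definition bump n (x0 : 'rV[R]_n) (r : R) (x : 'rV[R]_n) : R^o :=
  flat 0 (r ^+ 2 - \sum_(j < n) (x 0 j - x0 0 j) ^+ 2).

Lemma bump_gt0 n (x0 : 'rV[R]_n) r : 0 < r -> 0 < bump x0 r x0.
Proof.
move=> r0; rewrite /bump big1 => [|j _]; last by rewrite subrr expr0n.
by rewrite subr0 /flat exprn_gt0 // expr0 mul1r expR_gt0.
Qed.

(** If [x - x0] has sup norm above [r], so has one of its coordinates, whose
    square alone makes the argument of [flat] negative. *)
Lemma bump_support n (x0 : 'rV[R]_n) r x : 0 < r ->
  r < `|x - x0| -> bump x0 r x = 0.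
Proof.
move=> r0 rx; rewrite /bump /flat ifF //; apply/negbTE.
rewrite -leNgt subr_le0.
have [j jP] : exists j, r <= `|x 0 j - x0 0 j|.
  apply: contrapT => /forallNP H; move: rx; apply/negP; rewrite -leNgt.
  rewrite /Num.Def.normr /= mx_normrE; apply: bigmax_le; first exact: ltW.
  move=> [i j] _ /=; rewrite !mxE [i]ord1 ltW // ltNge.
  exact/negP/H.
rewrite (bigD1 j) //= -[leLHS]addr0 lerD //.
  by rewrite -[leRHS]real_normK ?num_real // ler_sqr ?nnegrE // ltW.
by apply: sumr_ge0 => i _; exact: sqr_ge0.
Qed.

Lemma smooth_bump n (x0 : 'rV[R]_n) r : smooth setT (bump x0 r).
Proof.
move=> k; apply: Ck_flat; first exact: openT.
apply: Ck_add; [exact: openT|exact: Ck_cst|].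
under eq_fun do rewrite -mulN1r.
apply: (@Ck_scale _ _ _ _ _ (fun=> -1 : R^o)); [exact: openT|exact: Ck_cst|].
apply: Ck_sum => [|j]; first exact: openT.
have C1 : Ck k setT (fun x : 'rV[R]_n => x 0 j - x0 0 j : R^o).
  apply: Ck_add; [exact: openT| |exact: Ck_cst].
  by apply: Ck_entry; [exact: openT|exact: (Ck_linear _ _ idfun)].
exact: (@Ck_scale _ _ R^o _ _ _ _ openT C1 C1).
Qed.

End Flat.

(** * Charts and germs of smooth functions *)

Lemma open_near (T : topologicalType) (U : set T) x :
  open U -> U x -> \forall y \near x, U y.
Proof. by move=> oU Ux; exact: open_nbhs_nbhs. Qed.

Section Charts.
Context {R : realType} {n : nat} {M : manifold R n}.
Implicit Types (c d : chart R n M) (p q : M) (V : normedModType R).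

Lemma chart_imageP c (U : set M) y :
  (cmap c @` (cdom c `&` U)) y <-> (cmap c @` cdom c) y /\ U (cinv c y).
Proof.
split; first by move=> [q [cq Uq] <-]; rewrite cmapK //; split => //; exists q.
by move=> [[q cq <-]]; rewrite cmapK // => Uq; exists q.
Qed.

Lemma cinvK c y : (cmap c @` cdom c) y -> cmap c (cinv c y) = y.
Proof. by move=> [q cq <-]; rewrite cmapK. Qed.

Lemma chart_image_open c (U : set M) : open U -> open (cmap c @` (cdom c `&` U)).
Proof.
move=> oU; rewrite openE => y yP; have [cy Uy] := (chart_imageP _ _ _).1 yP.
have n1 : \forall z \near y, (cmap c @` cdom c) z.
  exact: open_near (@cimg_open _ _ _ c) cy.
have n2 : \forall z \near y, U (cinv c z).
  by apply: (cinv_continuous cy); exact: open_nbhs_nbhs.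
rewrite /interior; near=> z; apply/chart_imageP; split; near: z; [exact: n1|exact: n2].
Unshelve. all: by end_near. Qed.

Lemma chart_preimage_open c (B : set 'rV[R]_n) :
  open B -> open (cdom c `&` cmap c @^-1` B).
Proof.
move=> oB; rewrite openE => q [cq Bq].
have n1 : \forall z \near q, cdom c z.
  exact: open_near (@cdom_open _ _ _ c) cq.
have n2 : \forall z \near q, B (cmap c z).
  by apply: (cmap_continuous cq); exact: open_nbhs_nbhs.
rewrite /interior; near=> z; split; near: z; [exact: n1|exact: n2].
Unshelve. all: by end_near. Qed.

Lemma near_chart c p (P : set M) : cdom c p ->
  (\forall q \near p, P q) -> \forall y \near cmap c p, P (cinv c y).
Proof.
move=> cp Pp; have yP : (cmap c @` cdom c) (cmap c p) by exists p.
by apply: (cinv_continuous yP); rewrite cmapK.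
Qed.

Lemma near_chart_image c p : cdom c p ->
  \forall y \near cmap c p, (cmap c @` cdom c) y.
Proof. by move=> cp; apply: open_near; [exact: cimg_open|exists p]. Qed.

Lemma near_cdom c p : cdom c p -> \forall q \near p, cdom c q.
Proof. by move=> cp; apply: open_near => //; exact: cdom_open. Qed.

(** Smoothness of the germ of [f] at [p], as read in the chart [c]; shown to be
    independent of [c] in [smooth_at_change]. *)
Definition smooth_at V c p (f : M -> V) : Prop :=
  exists B : set 'rV[R]_n, [/\ open B, B (cmap c p) & smooth B (f \o cinv c)].

Lemma smooth_atS V c p (f : M -> V) (P : set M) : cdom c p ->
  (\forall q \near p, P q) -> smooth_at c p f ->
  exists B : set 'rV[R]_n, [/\ open B, B (cmap c p), smooth B (f \o cinv c) &
    forall y, B y -> (cmap c @` cdom c) y /\ P (cinv c y)].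
Proof.
move=> cp Pp [B [oB Bp sB]].
have [W [oW Wp WP]] : exists W : set M, [/\ open W, W p & W `<=` P].
  have : nbhs p P by exact: Pp.
  by rewrite nbhsE => -[W [oW Wp] WP]; exists W.
exists (B `&` (cmap c @` (cdom c `&` W))); split.
- by apply: openI => //; exact: chart_image_open.
- by split=> //; exists p.
- by apply: smooth_subset sB => y [].
- by move=> y [_ /chart_imageP[cy /WP]].
Qed.

Lemma transition_smooth c d : atlas c -> atlas d ->
  smooth (cmap c @` (cdom c `&` cdom d)) (cmap d \o cinv c).
Proof. exact: atlas_compat. Qed.

(** The expression of [f] in [d] is its expression in [c] composed with a
    transition map. *)
Lemma smooth_at_change V c d p (f : M -> V) : atlas c -> atlas d ->
  cdom c p -> cdom d p -> smooth_at c p f -> smooth_at d p f.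
Proof.
move=> ac ad cp dp /(smooth_atS cp (near_cdom dp))[B [oB Bp sB BP]].
pose W := cdom c `&` cmap c @^-1` B.
have oW : open W by exact: chart_preimage_open.
exists (cmap d @` (cdom d `&` W)); split; first exact: chart_image_open.
  by exists p.
apply: (@smooth_eq _ _ _ _ (fun y => (f \o cinv c) ((cmap c \o cinv d) y))).
- exact: chart_image_open.
- by move=> y /chart_imageP[dy [cy By]] /=; rewrite cmapK.
- apply: smooth_comp sB; first exact: chart_image_open.
    by move=> y /chart_imageP[dy [cy By]].
  apply: smooth_subset (transition_smooth ad ac).
  by move=> y /chart_imageP[dy [cy By]]; apply/chart_imageP.
Qed.

Lemma smooth_at_near V c p (f g : M -> V) : cdom c p ->
  (\forall q \near p, f q = g q) -> smooth_at c p f -> smooth_at c p g.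
Proof.
move=> cp fg /(smooth_atS cp fg)[B [oB Bp sB BP]]; exists B; split => //.
by apply: smooth_eq sB => // y /BP[].
Qed.

Lemma smooth_at_differentiable V c p (f : M -> V) :
  smooth_at c p f -> differentiable (f \o cinv c) (cmap c p).
Proof. by move=> [B [oB Bp sB]]; exact: smooth_differentiable sB Bp. Qed.

Lemma smooth_atI c p (B B' : set 'rV[R]_n) : open B -> open B' ->
  B (cmap c p) -> B' (cmap c p) -> open (B `&` B') /\ (B `&` B') (cmap c p).
Proof. by move=> oB oB' Bp B'p; split=> //; exact: openI. Qed.

Lemma smooth_at_cst V c p (a : V) : smooth_at c p (fun=> a).
Proof. by exists setT; split=> //; [exact: openT|exact: smooth_cst]. Qed.

Lemma smooth_at_add V c p (f g : M -> V) :
  smooth_at c p f -> smooth_at c p g -> smooth_at c p (fun q => f q + g q).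
Proof.
move=> [B [oB Bp sf]] [B' [oB' B'p sg]].
have [oI Ip] := smooth_atI oB oB' Bp B'p.
exists (B `&` B'); split => //; apply: smooth_add => //.
  by apply: smooth_subset sf => y [].
by apply: smooth_subset sg => y [].
Qed.

Lemma smooth_at_scale V c p (a : M -> R^o) (f : M -> V) :
  smooth_at c p a -> smooth_at c p f -> smooth_at c p (fun q => a q *: f q).
Proof.
move=> [B [oB Bp sf]] [B' [oB' B'p sg]].
have [oI Ip] := smooth_atI oB oB' Bp B'p.
exists (B `&` B'); split => //.
apply: (smooth_scale (a := a \o cinv c) (f := f \o cinv c)) => //.
  by apply: smooth_subset sf => y [].
by apply: smooth_subset sg => y [].
Qed.

Lemma smooth_at_entry m c p (f : M -> 'rV[R]_m) j :
  smooth_at c p f -> smooth_at c p (fun q => f q 0 j : R^o).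
Proof.
move=> [B [oB Bp sf]]; exists B; split => //.
exact: (smooth_entry (f := f \o cinv c)).
Qed.

Lemma smooth_at_cmap c p : atlas c -> cdom c p -> smooth_at c p (cmap c).
Proof.
move=> ac cp; exists (cmap c @` (cdom c `&` cdom c)); split.
- by apply: chart_image_open; exact: cdom_open.
- by exists p.
- exact: transition_smooth.
Qed.

Lemma smooth_funP V (U : set M) (f : M -> V) : open U ->
  smooth_fun U f <-> forall p, U p -> smooth_at (chart_at p) p f.
Proof.
move=> oU; split=> [sf p Up|sf c ac].
  exists (cmap (chart_at p) @` (cdom (chart_at p) `&` U)); split.
  - exact: chart_image_open.
  - by exists p => //; split=> //; exact: chart_at_dom.
  - exact/sf/chart_at_atlas.
apply: smooth_pointwise => y [p [cp Up] <-].
have := smooth_at_change (chart_at_atlas p) ac (chart_at_dom p) cp (sf p Up).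
by move=> [B [oB Bp sB]]; apply: smooth_subset sB => z ->.
Qed.

(** How the differential of a function transforms under a change of charts;
    with [chart_at p] for [c] it computes [dfun p] in any chart. *)
Lemma diff_change V c d p (f : M -> V) w : atlas c -> atlas d ->
  cdom c p -> cdom d p ->
  differentiable (f \o cinv d) (cmap d p) ->
  differentiable (f \o cinv c) (cmap c p) /\
  'd (f \o cinv c) (cmap c p) w
    = 'd (f \o cinv d) (cmap d p) ('d (cmap d \o cinv c) (cmap c p) w).
Proof.
move=> ac ad cp dp df.
have cdp : (cmap c @` (cdom c `&` cdom d)) (cmap c p) by exists p.
have /differentiableP dt := smooth_differentiable (transition_smooth ac ad) cdp.
have df' : is_diff ((cmap d \o cinv c) (cmap c p)) (f \o cinv d)
    ('d (f \o cinv d) (cmap d p)).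
  by rewrite /= cmapK //; exact/differentiableP.
have dc := is_diff_comp dt df'.
have E : \forall y \near cmap c p,
    ((f \o cinv d) \o (cmap d \o cinv c)) y = (f \o cinv c) y.
  by apply: filterS (near_chart cp (near_cdom dp)) => y dy /=; rewrite cmapK.
have dc' := near_eq_is_diff E dc.
by split; [have [] := dc'|exact: (is_diff_apply w dc')].
Qed.

Lemma dfunE V c p (f : M -> V) u : atlas c -> cdom c p ->
  differentiable (f \o cinv c) (cmap c p) ->
  dfun p f u = 'd (f \o cinv c) (cmap c p) (coord c p u).
Proof.
move=> ac cp df.
exact: (diff_change u (chart_at_atlas p) ac (chart_at_dom p) cp df).2.
Qed.

Lemma diff_transition_id c p w : cdom c p -> 'd (cmap c \o cinv c) (cmap c p) w = w.
Proof.
move=> cp.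
have E : \forall y \near cmap c p, y = (cmap c \o cinv c) y.
  by apply: filterS (near_chart_image cp) => y cy /=; rewrite cinvK.
exact: is_diff_apply (near_eq_is_diff E (is_diff_id _)).
Qed.

Lemma coord_chart_at p u : coord (chart_at p) p u = u.
Proof. exact/diff_transition_id/chart_at_dom. Qed.

Lemma coord_change c d p u : atlas c -> atlas d -> cdom c p -> cdom d p ->
  coord d p u = 'd (cmap d \o cinv c) (cmap c p) (coord c p u).
Proof.
move=> ac ad cp dp; apply: dfunE => //.
apply: smooth_differentiable (transition_smooth ac ad) _.
by exists p.
Qed.

Lemma coord_frame c d p i : atlas c -> atlas d -> cdom c p -> cdom d p ->
  coord d p (frame c i p) = 'd (cmap d \o cinv c) (cmap c p) (delta_mx 0 i).
Proof.
move=> ac ad cp dp.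
apply/esym.
apply: (diff_change _ ac (chart_at_atlas p) cp (chart_at_dom p) _).2.
apply: smooth_differentiable (transition_smooth (chart_at_atlas p) ad) _.
by exists p => //; split => //; exact: chart_at_dom.
Qed.

Lemma coord_frame_id c p i : atlas c -> cdom c p ->
  coord c p (frame c i p) = delta_mx 0 i.
Proof. by move=> ac cp; rewrite coord_frame // diff_transition_id. Qed.

Lemma frame_expand c p u : atlas c -> cdom c p ->
  u = \sum_(i < n) coord c p u 0 i *: frame c i p.
Proof.
move=> ac cp; rewrite -{1}[u](coord_chart_at p).
rewrite (coord_change _ ac (chart_at_atlas p) cp (chart_at_dom p)).
exact: linear_deltaE.
Qed.

End Charts.

(** * Vector fields and their bracket *)

Section Fields.
Context {R : realType} {n : nat} {M : manifold R n}.
Implicit Types (c d : chart R n M) (p q : M) (V : normedModType R).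
Implicit Types (X Y : vfield M).

Definition field_at c p X : Prop := smooth_at c p (fun q => coord c q (X q)).

(** The local expression of a derivative is valid on a whole neighbourhood,
    which is what allows differentiating it again. *)
Lemma dfun_chart V c p (G : M -> V) : atlas c -> cdom c p -> smooth_at c p G ->
  exists B : set 'rV[R]_n, [/\ open B, B (cmap c p), smooth B (G \o cinv c) &
    forall y, B y -> forall u,
      dfun (cinv c y) G u = 'd (G \o cinv c) y (coord c (cinv c y) u)].
Proof.
move=> ac cp /(smooth_atS cp (near_cdom cp))[B [oB Bp sB BP]].
exists B; split => // y By u; have [cy cdy] := BP y By.
have df : differentiable (G \o cinv c) (cmap c (cinv c y)).
  by rewrite (cinvK cy); exact: smooth_differentiable sB By.
by have := dfunE u ac cdy df; rewrite (cinvK cy).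
Qed.

Lemma smooth_at_dfun V c p (G : M -> V) Y : atlas c -> cdom c p ->
  smooth_at c p G -> field_at c p Y -> smooth_at c p (fun q => dfun q G (Y q)).
Proof.
move=> ac cp sG [B' [oB' B'p sY]].
have [B [oB Bp sB BE]] := dfun_chart ac cp sG.
have [oI Ip] := smooth_atI oB oB' Bp B'p.
exists (B `&` B'); split => //.
apply: (@smooth_eq _ _ _ _ (fun y => 'd (G \o cinv c) y
    (((fun q => coord c q (Y q)) \o cinv c) y))) => //.
  by move=> y [By _] /=; rewrite BE.
apply: smooth_diff_field => //.
  by apply: smooth_subset sB => y [].
by apply: smooth_subset sY => y [].
Qed.

(** The components of [X] in [d] are the derivatives of [cmap d] along [X], so
    that this is a case of [smooth_at_dfun]. *)
Lemma field_at_change c d p X : atlas c -> atlas d -> cdom c p -> cdom d p ->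
  field_at c p X -> field_at d p X.
Proof.
move=> ac ad cp dp fX; apply: (smooth_at_change ac ad cp dp).
apply: smooth_at_dfun => //.
exact: smooth_at_change ad ac dp cp (smooth_at_cmap ad dp).
Qed.

Lemma smooth_fieldP (U : set M) X : open U ->
  smooth_field U X <-> forall p, U p -> field_at (chart_at p) p X.
Proof.
move=> oU; split=> [sX p Up|sX c d ac ad].
  exists (cmap (chart_at p) @` (cdom (chart_at p) `&` U `&` cdom (chart_at p))).
  split; last exact: (sX _ _ (chart_at_atlas p) (chart_at_atlas p)).
    by rewrite -setIA; apply: chart_image_open; apply: openI => //; exact: cdom_open.
  by exists p => //; split; [split=> //|]; exact: chart_at_dom.
apply: smooth_pointwise => y [p [[cp Up] dp] <-].
have [B [oB Bp sB]] : smooth_at c p (fun q => coord d q (X q)).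
  apply: (smooth_at_change ad ac dp cp).
  exact: field_at_change (chart_at_atlas p) ad (chart_at_dom p) dp (sX p Up).
by apply: smooth_subset sB => z ->.
Qed.

Lemma field_at_frame c p i : atlas c -> cdom c p -> field_at c p (frame c i).
Proof.
move=> ac cp; apply: (smooth_at_near cp _ (smooth_at_cst c p (delta_mx 0 i))).
by apply: filterS (near_cdom cp) => q cq; rewrite coord_frame_id.
Qed.

Lemma smooth_field_frame c i : atlas c -> smooth_field (cdom c) (frame c i).
Proof.
move=> ac; apply/smooth_fieldP => [|p cp]; first exact: cdom_open.
exact: field_at_change ac (chart_at_atlas p) cp (chart_at_dom p) (field_at_frame _ ac cp).
Qed.

Lemma field_at_near c p X Y : cdom c p ->
  (\forall q \near p, X q = Y q) -> field_at c p X -> field_at c p Y.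
Proof.
by move=> cp XY; apply: smooth_at_near => //; apply: filterS XY => q ->.
Qed.

Lemma coord0 c p : coord c p 0 = 0.
Proof. by rewrite /coord /dfun linear0. Qed.

Lemma coordD c p u v : coord c p (u + v) = coord c p u + coord c p v.
Proof. by rewrite /coord /dfun linearD. Qed.

Lemma coordZ c p a u : coord c p (a *: u) = a *: coord c p u.
Proof. by rewrite /coord /dfun linearZ. Qed.

Lemma field_at_add c p X Y :
  field_at c p X -> field_at c p Y -> field_at c p (fun q => X q + Y q).
Proof.
move=> fX fY; have := smooth_at_add fX fY.
congr (smooth_at c p _); apply/funext => q.
by rewrite coordD.
Qed.

Lemma field_at_scale c p (a : M -> R^o) X :
  smooth_at c p a -> field_at c p X -> field_at c p (fun q => a q *: X q).
Proof.
move=> sa fX; have := smooth_at_scale sa fX.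
by congr (smooth_at c p _); apply/funext => q; rewrite coordZ.
Qed.

Lemma field_at_0 c p : field_at c p (fun=> 0).
Proof.
have := @smooth_at_cst R n M _ c p (0 : 'rV[R]_n).
congr (smooth_at c p _); apply/funext => q.
by rewrite coord0.
Qed.

(** Symmetry of second derivatives makes the bracket natural: a function [G]
    turns it into the commutator of the derivations [X] and [Y]. *)
Lemma dfun_bracket m p (G : M -> 'rV[R]_m) X Y :
  smooth_at (chart_at p) p G ->
  field_at (chart_at p) p X -> field_at (chart_at p) p Y ->
  dfun p G (bracket X Y p) = dfun p (fun q => dfun q G (Y q)) (X p)
                           - dfun p (fun q => dfun q G (X q)) (Y p).
Proof.
move=> sG fX fY; set c := chart_at p; set x := cmap c p.
have ac : atlas c by exact: chart_at_atlas.
have cp : cdom c p by exact: chart_at_dom.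
have [B [oB Bx sB BE]] := dfun_chart ac cp sG.
have E Z u : field_at c p Z -> dfun p (fun q => dfun q G (Z q)) u =
   'd (fun y => 'd (G \o cinv c) y (Z p)) x u
   + 'd (G \o cinv c) x (dfun p (fun q => coord c q (Z q)) u).
  move=> fZ.
  have /differentiableP dZ := smooth_at_differentiable fZ.
  have dd := is_diff_diff_field Bx sB dZ.
  have Zp : ((fun q => coord c q (Z q)) \o cinv c) x = Z p.
    by rewrite /= cmapK // coord_chart_at.
  rewrite Zp in dd.
  have nE : \forall y \near x, 'd (G \o cinv c) y (((fun q => coord c q (Z q)) \o cinv c) y)
      = ((fun q => dfun q G (Z q)) \o cinv c) y.
    by apply: filterS (open_near oB Bx) => y By /=; rewrite BE.
  exact: is_diff_apply u (near_eq_is_diff nE dd).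
have S := diff_diff_sym (Y p) (X p) oB Bx sB.
have aux (V : zmodType) (u v w z : V) : u = w -> u + v - (w + z) = v - z.
  by move=> ->; rewrite opprD addrACA subrr add0r.
rewrite (E X (Y p) fX) (E Y (X p) fY) (aux _ _ _ _ _ S).
exact: (linearB ('d (G \o cinv c) x)).
Qed.

(** The components of the bracket in a chart [c] are the derivatives of
    [cmap c] along it; by naturality they are derivatives of components of [X]
    and [Y]. *)
Lemma smooth_bracket X Y : smooth_field setT X -> smooth_field setT Y ->
  smooth_field setT (bracket X Y).
Proof.
move=> sX sY.
have fX c p : atlas c -> cdom c p -> field_at c p X.
  move=> ac cp; apply: (field_at_change (chart_at_atlas p) ac (chart_at_dom p) cp).
  by move/smooth_fieldP: sX; apply => //; exact: openT.
have fY c p : atlas c -> cdom c p -> field_at c p Y.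
  move=> ac cp; apply: (field_at_change (chart_at_atlas p) ac (chart_at_dom p) cp).
  by move/smooth_fieldP: sY; apply => //; exact: openT.
apply/smooth_fieldP => [|p _]; first exact: openT.
set c := chart_at p.
have ac : atlas c by exact: chart_at_atlas.
have cp : cdom c p by exact: chart_at_dom.
have S Z W : field_at c p Z -> field_at c p W ->
  smooth_at c p (fun q => dfun q (fun r => coord c r (Z r)) (W q)).
  by move=> fZ fW; exact: smooth_at_dfun.
have := smooth_at_add (S Y X (fY _ _ ac cp) (fX _ _ ac cp))
  (smooth_at_scale (smooth_at_cst c p (-1 : R^o)) (S X Y (fX _ _ ac cp) (fY _ _ ac cp))).
apply: smooth_at_near => //; apply: filterS (near_cdom cp) => q cq.
have aq := chart_at_atlas q; have dq := chart_at_dom q.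
have sG := smooth_at_change ac aq cq dq (smooth_at_cmap ac cq).
by rewrite scaleN1r; apply/esym; exact: dfun_bracket sG (fX _ _ aq dq) (fY _ _ aq dq).
Qed.

End Fields.

(** * Extending local fields to the whole manifold *)

Section Extension.
Context {R : realType} {n : nat} {M : manifold R n}.
Implicit Types (p q : M) (X : vfield M).

Lemma closed_ball_compact (x0 : 'rV[R]_n) (r : R) :
  compact (closed_ball_ Num.Def.normr x0 r).
Proof.
apply: bounded_closed_compact; last exact: closed_closed_ball_.
exists (`|x0| + r); split; first exact: num_real.
move=> e re y /= xy; apply: le_trans (ltW re).
rewrite -[y](subrK x0) addrC; apply: le_trans (ler_normD _ _) _.
by rewrite lerD2l distrC.
Qed.

Lemma chart_ball p (U : set M) : open U -> U p ->
  exists2 r : R, 0 < r &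
  closed_ball_ Num.Def.normr (cmap (chart_at p) p) r
    `<=` cmap (chart_at p) @` (cdom (chart_at p) `&` U).
Proof.
move=> oU Up; set c := chart_at p.
have : \forall y \near cmap c p, (cmap c @` (cdom c `&` U)) y.
  apply: open_near; first exact: chart_image_open.
  by exists p => //; split => //; exact: chart_at_dom.
move=> /nbhs_normP[r /= r0 rP]; exists (r / 2); first by rewrite divr_gt0.
move=> y /= xy; apply: rP; rewrite /= (le_lt_trans xy) //.
by rewrite ltr_pdivrMr // ltr_pMr // ltr1n.
Qed.

(** Multiplying by a bump function turns a field near [p] into a global one.
    The extension by 0 is smooth because the support of the bump function is
    compact, hence closed, the manifold being Hausdorff. *)
Lemma smooth_field_cutoff p (U : set M) X : open U -> U p -> smooth_field U X ->
  exists b : M -> R^o, [/\ b p != 0, forall q, b q != 0 -> U q &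
    smooth_field setT (fun q => b q *: X q)].
Proof.
move=> oU Up /(smooth_fieldP _ oU) sX; set c := chart_at p.
have ac : atlas c by exact: chart_at_atlas.
have cp : cdom c p by exact: chart_at_dom.
have [r r0 rP] := chart_ball oU Up; rewrite -/c in rP; set x0 := cmap c p in rP.
pose b q : R^o := if pselect (cdom c q) then bump x0 r (cmap c q) else 0.
have bE q : cdom c q -> b q = bump x0 r (cmap c q).
  by move=> cq; rewrite /b; case: pselect.
(* A compact subset of the domain of the chart, outside of which [b] is 0. *)
pose K : set M := cinv c @` closed_ball_ Num.Def.normr x0 r.
have b0 q : ~ K q -> b q = 0.
  rewrite /b; case: pselect => // cq Kq.
  apply: bump_support => //; rewrite ltNge; apply/negP => h; apply: Kq.
  by exists (cmap c q); [rewrite /closed_ball_ /= distrC|rewrite cmapK].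
have KU q : K q -> cdom c q /\ U q.
  by move=> [y /rP[z [cz Uz] <-] <-]; rewrite cmapK.
have Kclosed : closed K.
  apply: compact_closed; first exact: mfd_hausdorff.
  apply: continuous_compact; last exact: closed_ball_compact.
  apply: continuous_in_subspaceT => y; rewrite inE => /rP yP.
  apply: cinv_continuous.
  by have [] := (chart_imageP _ _ _).1 yP.
exists b; split.
- by rewrite (bE _ cp) gt_eqF // bump_gt0.
- by move=> q; apply: contraNP => /= nU; apply/eqP/b0 => /KU[].
apply/smooth_fieldP => [|q _]; first exact: openT.
have [/KU[cq Uq]|nK] := pselect (K q).
  apply: field_at_scale (sX q Uq).
  apply: (smooth_at_change ac (chart_at_atlas q) cq (chart_at_dom q)).
  apply: (@smooth_at_near _ _ _ _ c q (fun z => bump x0 r (cmap c z))) => //.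
    by apply: filterS (near_cdom cq) => z cz; rewrite bE.
  have [B [oB Bq sB]] := smooth_at_cmap ac cq.
  exists B; split => //.
  apply: smooth_comp (smooth_bump x0 r) => //.
apply: (@field_at_near _ _ _ _ q (fun=> 0)).
- exact: chart_at_dom.
- have : \forall z \near q, (~` K) z.
    by apply: open_near => //; exact: closed_openC.
  by apply: filterS => z Kz; rewrite b0 // scale0r.
- exact: field_at_0.
Qed.

Lemma smooth_field_sum (U : set M) (I : Type) (s : seq I) (a : I -> R)
    (E : I -> vfield M) : open U -> (forall i, smooth_field U (E i)) ->
  smooth_field U (fun q => \sum_(i <- s) a i *: E i q).
Proof.
move=> oU sE; apply/smooth_fieldP => // p Up.
elim: s => [|i s IH].
  by under eq_fun do rewrite big_nil; exact: field_at_0.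
under eq_fun do rewrite big_cons.
apply: field_at_add IH; apply: field_at_scale; first exact: smooth_at_cst.
by move/smooth_fieldP: (sE i); apply.
Qed.

Lemma span_image_coef (vT : vectType R) m (e : 'I_m -> vT) v :
  v \in <<[seq e i | i : 'I_m]>>%VS -> exists a : 'I_m -> R, v = \sum_i a i *: e i.
Proof.
rewrite span_def big_image /= => /memv_sumP[w wP ->].
have /(_ _)/cid-/all_sig[a aP] : forall i, exists k, w i = k *: e i.
  by move=> i; apply/vlineP; exact: wP.
by exists a; apply: eq_bigr => i _; exact: aP.
Qed.

(** Extend [v] with constant coefficients on a local frame of [D], cut off, and
    rescale to undo the value of the cut-off function at [p]. *)
Lemma section_through (D : M -> {vspace 'rV[R]_n}) m :
  (forall p, exists (U : set M) (E : 'I_m -> vfield M),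
    [/\ open U, U p, forall i, smooth_field U (E i) &
        forall q, U q -> D q = <<[seq E i q | i : 'I_m]>>%VS]) ->
  forall p v, v \in D p ->
  exists Z : vfield M, section (fun q => [set` D q]) Z /\ Z p = v.
Proof.
move=> locD p v vD; have [U [E [oU Up sE DE]]] := locD p.
have [a va] : exists a : 'I_m -> R, v = \sum_i a i *: E i p.
  by apply: span_image_coef; rewrite -DE.
pose X : vfield M := fun q => \sum_i a i *: E i q.
have XD q : U q -> X q \in D q.
  move=> Uq; rewrite DE //; apply: memv_suml => i _; apply: memvZ.
  by apply: memv_span; apply: map_f; rewrite mem_enum.
have [b [bp bU sb]] := smooth_field_cutoff oU Up (smooth_field_sum (index_enum _) a oU sE).
exists (fun q => (b p)^-1 *: (b q *: X q)); split; last first.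
  by rewrite scalerA mulVf // scale1r.
split.
  apply/smooth_fieldP => [|q _]; first exact: openT.
  apply: field_at_scale; first exact: smooth_at_cst.
  by move/smooth_fieldP: sb; apply => //; exact: openT.
move=> q /=; have [->|/bU Uq] := eqVneq (b q) 0.
  by rewrite scale0r scaler0 mem0v.
by do 2! apply: memvZ; exact: XD.
Qed.

End Extension.

(** * Derivatives at a point of a manifold *)

Section Dfun.
Context {R : realType} {n : nat} {M : manifold R n}.
Implicit Types (p q : M) (V : normedModType R).

Definition is_dfun V p (f : M -> V) (df : 'rV[R]_n -> V) : Prop :=
  is_diff (cmap (chart_at p) p) (f \o cinv (chart_at p)) df.

Definition mdiff V p (f : M -> V) : Prop :=
  differentiable (f \o cinv (chart_at p)) (cmap (chart_at p) p).

Lemma mdiffP V p (f : M -> V) : mdiff p f -> is_dfun p f (dfun p f).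
Proof. exact: differentiableP. Qed.

Lemma is_dfun_mdiff V p (f : M -> V) df : is_dfun p f df -> mdiff p f.
Proof. by case. Qed.

Lemma is_dfunE V p (f : M -> V) df u : is_dfun p f df -> dfun p f u = df u.
Proof. exact: is_diff_apply. Qed.

Lemma near_eq_is_dfun V p (f g : M -> V) df :
  (\forall q \near p, f q = g q) -> is_dfun p f df -> is_dfun p g df.
Proof. by move=> fg; apply: near_eq_is_diff; exact: near_chart (chart_at_dom p) fg. Qed.

Lemma is_dfun_cst V p (a : V) : is_dfun p (fun=> a) (fun=> 0).
Proof. exact: is_diff_cst. Qed.

Lemma is_dfun_add V p (f g : M -> V) df dg : is_dfun p f df -> is_dfun p g dg ->
  is_dfun p (fun q => f q + g q) (fun u => df u + dg u).
Proof. exact: is_diffD. Qed.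

Lemma is_dfun_scale V p (a : M -> R^o) (f : M -> V) da df :
  is_dfun p a da -> is_dfun p f df ->
  is_dfun p (fun q => a q *: f q) (fun u => a p *: df u + da u *: f p).
Proof.
move=> ha hf; have := is_diff_scale ha hf; rewrite /= cmapK //.
exact: chart_at_dom.
Qed.

Lemma is_dfun_sum V p (I : Type) (r : seq I) (f : I -> M -> V) df :
  (forall i, is_dfun p (f i) (df i)) ->
  is_dfun p (fun q => \sum_(i <- r) f i q) (fun u => \sum_(i <- r) df i u).
Proof. exact: is_diff_sum. Qed.

Lemma mdiff_entry m p (f : M -> 'rV[R]_m) j :
  mdiff p f -> is_dfun p (fun q => f q 0 j : R^o) (fun u => dfun p f u 0 j).
Proof. exact: diff_entry. Qed.

Lemma mdiff_add V p (f g : M -> V) :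
  mdiff p f -> mdiff p g -> mdiff p (fun q => f q + g q).
Proof. by move=> /mdiffP df /mdiffP dg; exact: is_dfun_mdiff (is_dfun_add df dg). Qed.

Lemma mdiff_scale V p (a : M -> R^o) (f : M -> V) :
  mdiff p a -> mdiff p f -> mdiff p (fun q => a q *: f q).
Proof. by move=> /mdiffP df /mdiffP dg; exact: is_dfun_mdiff (is_dfun_scale df dg). Qed.

Lemma mdiff_cst V p (a : V) : mdiff p (fun=> a).
Proof. exact: is_dfun_mdiff (is_dfun_cst p a). Qed.

Lemma mdiff_sum V p (I : Type) (r : seq I) (f : I -> M -> V) :
  (forall i, mdiff p (f i)) -> mdiff p (fun q => \sum_(i <- r) f i q).
Proof.
by move=> df; exact: is_dfun_mdiff (is_dfun_sum r (fun i => mdiffP (df i))).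
Qed.

Lemma mdiff_near V p (f g : M -> V) :
  (\forall q \near p, f q = g q) -> mdiff p f -> mdiff p g.
Proof. by move=> fg /mdiffP df; exact: is_dfun_mdiff (near_eq_is_dfun fg df). Qed.

Lemma dfun_near V p (f g : M -> V) u :
  (\forall q \near p, f q = g q) -> mdiff p f -> dfun p f u = dfun p g u.
Proof. by move=> fg /mdiffP df; exact/esym/(is_dfunE u (near_eq_is_dfun fg df)). Qed.

Lemma smooth_at_mdiff V p (f : M -> V) : smooth_at (chart_at p) p f -> mdiff p f.
Proof. exact: smooth_at_differentiable. Qed.

End Dfun.

(** * Connections depend on germs only *)

Section Connection.
Context {R : realType} {n : nat} {N : manifold R n} (D : connection N).
Implicit Types (r : N) (c : chart R n N).

Lemma connection0 r w : D r w (fun=> 0) = 0.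
Proof.
have s0 : smooth_field setT ((fun=> 0) : vfield N).
  by apply/smooth_fieldP => [|q _]; [exact: openT|exact: field_at_0].
have := connection_add D (p := r) w openT s0 s0 I.
under [X in D r w X = _]eq_fun do rewrite addr0.
by move=> /(congr1 (fun x => x - D r w (fun=> 0))); rewrite subrr addrK.
Qed.

Lemma connection_sum (U : set N) (I : Type) (s : seq I) (Y : I -> vfield N) r w :
  open U -> (forall i, smooth_field U (Y i)) -> U r ->
  D r w (fun q => \sum_(i <- s) Y i q) = \sum_(i <- s) D r w (Y i).
Proof.
move=> oU sY Ur; elim: s => [|i s IH].
  by under eq_fun do rewrite big_nil; rewrite big_nil connection0.
under eq_fun do rewrite big_cons; rewrite big_cons -IH.
rewrite (connection_add _ w oU) //.
have -> : (fun q => \sum_(j <- s) Y j q) = (fun q => \sum_(j <- s) 1 *: Y j q).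
  by apply/funext => q; apply: eq_bigr => j _; rewrite scale1r.
exact: (smooth_field_sum s (fun=> 1)).
Qed.

Lemma smooth_fun_near (U : set N) (f : N -> R^o) (a : R) : open U ->
  (forall q, U q -> f q = a) -> smooth_fun U f.
Proof.
move=> oU fa; apply/smooth_funP => // q Uq.
apply: (@smooth_at_near _ _ _ _ _ q (fun=> a)) (smooth_at_cst _ _ _).
  exact: chart_at_dom.
by apply: filterS (open_near oU Uq) => z Uz; rewrite fa.
Qed.

(** Multiplying by an indicator function does not change a covariant
    derivative, which therefore depends on germs only. *)
Lemma connection_local (U : set N) (Y Z : vfield N) r w : open U ->
  smooth_field U Y -> smooth_field U Z -> U r ->
  (forall q, U q -> Y q = Z q) -> D r w Y = D r w Z.
Proof.
move=> oU sY sZ Ur YZ.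
pose f q : R^o := if pselect (U q) then 1 else 0.
have f1 q : U q -> f q = 1 by rewrite /f; case: pselect.
have sf : smooth_fun U f by exact: smooth_fun_near f1.
have df : dfun r f w = 0.
  have h : \forall q \near r, 1 = f q.
    by apply: filterS (open_near oU Ur) => q /f1.
  exact: is_dfunE w (near_eq_is_dfun h (is_dfun_cst r (1 : R^o))).
have E T : smooth_field U T -> D r w (fun q => f q *: T q) = D r w T.
  by move=> sT; rewrite (connection_leibniz _ w oU) // df f1 // scale0r add0r scale1r.
rewrite -(E Y sY) -(E Z sZ); congr (D r w _); apply/funext => q.
rewrite /f; case: pselect => Uq; last by rewrite !scale0r.
by rewrite YZ.
Qed.

(** The expansion of [W] in the coordinate fields holds only on the domain of
    the chart; locality makes the Leibniz rule applicable to it. *)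
Lemma connection_frame c (W : vfield N) r w : atlas c -> cdom c r ->
  smooth_field (cdom c) W ->
  D r w W = \sum_(i < n) (dfun r (fun q => coord c q (W q) 0 i : R^o) w *: frame c i r
     + coord c r (W r) 0 i *: D r w (frame c i)).
Proof.
move=> ac cr sW.
have oc : open (cdom c) by exact: cdom_open.
have sf i := smooth_field_frame i ac.
pose a i : N -> R^o := fun q => coord c q (W q) 0 i.
have fW q : cdom c q -> field_at c q W.
  move=> cq; apply: (field_at_change (chart_at_atlas q) ac (chart_at_dom q) cq).
  by move/smooth_fieldP: sW; apply.
have sa i : smooth_fun (cdom c) (a i).
  apply/smooth_funP => // q cq.
  apply: (smooth_at_change ac (chart_at_atlas q) cq (chart_at_dom q)).
  exact: smooth_at_entry (fW q cq).
have saf i : smooth_field (cdom c) (fun q => a i q *: frame c i q).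
  apply/smooth_fieldP => // q cq; apply: field_at_scale.
    by move/smooth_funP: (sa i); apply.
  by move/smooth_fieldP: (sf i); apply.
have sS : smooth_field (cdom c) (fun q => \sum_(i < n) a i q *: frame c i q).
  have -> : (fun q => \sum_(i < n) a i q *: frame c i q) =
            (fun q => \sum_(i < n) 1 *: (a i q *: frame c i q)).
    by apply/funext => q; apply: eq_bigr => j _; rewrite scale1r.
  exact: (smooth_field_sum _ (fun=> 1)).
rewrite (connection_local (Z := fun q => \sum_(i < n) a i q *: frame c i q) w oc) //.
  rewrite (connection_sum _ w oc) //; apply: eq_bigr => i _.
  by rewrite (connection_leibniz _ w oc).
by move=> q cq; rewrite {1}(frame_expand (W q) ac cq).
Qed.

End Connection.

(** * Bilinear algebra of a metric *)

Section MetricAlgebra.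
Context {R : realType} {n : nat} {N : manifold R n} (g : metric N).
Implicit Types (r : N).

Lemma metricDr r u v w : g r u (v + w) = g r u v + g r u w.
Proof. by have := metric_linear g r u 1 v w; rewrite scale1r mul1r. Qed.

Lemma metric0r r u : g r u 0 = 0.
Proof.
have := metricDr r u 0 0; rewrite addr0 => /(congr1 (fun x => x - g r u 0)).
by rewrite subrr addrK.
Qed.

Lemma metricZr r u a v : g r u (a *: v) = a * g r u v.
Proof. by have := metric_linear g r u a v 0; rewrite !addr0 metric0r addr0. Qed.

Lemma metricNr r u v : g r u (- v) = - g r u v.
Proof. by rewrite -scaleN1r metricZr mulN1r. Qed.

Lemma metricBr r u v w : g r u (v - w) = g r u v - g r u w.
Proof. by rewrite metricDr metricNr. Qed.

Lemma metricDl r u v w : g r (u + v) w = g r u w + g r v w.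
Proof. by rewrite metric_sym metricDr !(metric_sym g r w). Qed.

Lemma metricZl r a u v : g r (a *: u) v = a * g r u v.
Proof. by rewrite metric_sym metricZr metric_sym. Qed.

Lemma metricBl r u v w : g r (u - v) w = g r u w - g r v w.
Proof. by rewrite metric_sym metricBr !(metric_sym g r w). Qed.

Lemma metric0l r u : g r 0 u = 0.
Proof. by rewrite metric_sym metric0r. Qed.

Lemma metric_sumr r u (I : Type) (s : seq I) (f : I -> 'rV[R]_n) :
  g r u (\sum_(j <- s) f j) = \sum_(j <- s) g r u (f j).
Proof.
by elim: s => [|j s IH]; rewrite ?big_nil ?metric0r // !big_cons metricDr IH.
Qed.

Lemma metric_eq0 r u : g r u u = 0 -> u = 0.
Proof.
move=> uu; apply/eqP; apply: contraTT isT => u0.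
by have := metric_pos g r u0; rewrite uu ltxx.
Qed.

End MetricAlgebra.

(** * The connection pulled back along a smooth map *)

Section Along.
Context {R : realType} {k n : nat} {M : manifold R k} {N : manifold R n}.
Context (F : M -> N) (sF : smooth_map F).
Implicit Types (p q : M) (V W : M -> 'rV[R]_n).

Lemma near_map p (P : N -> Prop) :
  (\forall r \near F p, P r) -> \forall q \near p, P (F q).
Proof. by move=> h; exact: (sF.1 p). Qed.

Lemma near_map_dom (e : chart R n N) p : cdom e (F p) -> \forall q \near p, cdom e (F q).
Proof. by move=> ep; exact: near_map (near_cdom ep). Qed.

Lemma smooth_at_map (c : chart R k M) (e : chart R n N) p : atlas c -> atlas e ->
  cdom c p -> cdom e (F p) -> smooth_at c p (cmap e \o F).
Proof.
move=> ac ae cp ep; exists (cmap c @` (cdom c `&` F @^-1` cdom e)); split.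
- apply: chart_image_open; apply: open_comp; last exact: cdom_open.
  by move=> q _; exact: sF.1.
- by exists p.
- exact: sF.2.
Qed.

Lemma dfun_comp (V0 : normedModType R) (e : chart R n N) p (h : N -> V0) :
  atlas e -> cdom e (F p) -> smooth_at e (F p) h ->
  is_dfun p (fun q => h (F q)) (fun u => dfun (F p) h (dmap F p u)).
Proof.
move=> ae ep sh; set c := chart_at p; set e' := chart_at (F p).
have ac : atlas c by exact: chart_at_atlas.
have cp : cdom c p by exact: chart_at_dom.
have ae' : atlas e' by exact: chart_at_atlas.
have ep' : cdom e' (F p) by exact: chart_at_dom.
have /smooth_at_mdiff dh := smooth_at_change ae ae' ep ep' sh.
have /differentiableP dF := smooth_at_differentiable (smooth_at_map ac ae' cp ep').
have dh' : is_diff (((cmap e' \o F) \o cinv c) (cmap c p)) (h \o cinv e') (dfun (F p) h).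
  by rewrite /= cmapK //; exact: mdiffP.
have dc := is_diff_comp dF dh'.
apply: (near_eq_is_diff _ dc).
by apply: filterS (near_chart cp (near_map_dom ep')) => y ey /=; rewrite cmapK.
Qed.

Lemma coord_dmap (e : chart R n N) p u : atlas e -> cdom e (F p) ->
  coord e (F p) (dmap F p u) = dfun p (cmap e \o F) u.
Proof.
move=> ae ep; apply/esym.
exact: (is_dfunE u (dfun_comp ae ep (smooth_at_cmap ae ep))).
Qed.

Lemma dmapZ p a u : dmap F p (a *: u) = a *: dmap F p u.
Proof. by rewrite /dmap /dfun linearZ. Qed.

Lemma dmapD p u v : dmap F p (u + v) = dmap F p u + dmap F p v.
Proof. by rewrite /dmap /dfun linearD. Qed.

Lemma dmapB p u v : dmap F p (u - v) = dmap F p u - dmap F p v.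
Proof. by rewrite /dmap /dfun linearB. Qed.

Lemma dmap_sum p (I : Type) (s : seq I) (P : pred I) (f : I -> 'rV[R]_k) :
  dmap F p (\sum_(i <- s | P i) f i) = \sum_(i <- s | P i) dmap F p (f i).
Proof. by rewrite /dmap /dfun linear_sum. Qed.

(** The components of a vector field along [F] in the chart in which tangent
    vectors at [F p] are written. *)
Definition components p V : M -> 'rV[R]_n := fun q => coord (chart_at (F p)) (F q) (V q).

Lemma components_at p V : components p V p = V p.
Proof. exact: coord_chart_at. Qed.

Lemma componentsD p V W : components p (fun q => V q + W q)
  = fun q => components p V q + components p W q.
Proof. by apply/funext => q; exact: coordD. Qed.

Lemma componentsZ p (a : M -> R) V : components p (fun q => a q *: V q)
  = fun q => a q *: components p V q.
Proof. by apply/funext => q; exact: coordZ. Qed.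

Lemma along_expand p V : \forall q \near p,
  V q = \sum_(i < n) components p V q 0 i *: frame (chart_at (F p)) i (F q).
Proof.
have h := near_map_dom (chart_at_dom (F p)).
by apply: filterS h => q eFq; apply: frame_expand => //; exact: chart_at_atlas.
Qed.

Definition along_diff p V : Prop := mdiff p (components p V).

Lemma along_diff_near p V W : (\forall q \near p, V q = W q) ->
  along_diff p V -> along_diff p W.
Proof.
move=> VW; apply: mdiff_near.
by apply: filterS VW => q VWq; rewrite /components VWq.
Qed.

Lemma along_diff_add p V W : along_diff p V -> along_diff p W ->
  along_diff p (fun q => V q + W q).
Proof. by move=> dV dW; rewrite /along_diff componentsD; exact: mdiff_add. Qed.

Lemma along_diff_scale p (a : M -> R^o) V : mdiff p a -> along_diff p V ->
  along_diff p (fun q => a q *: V q).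
Proof. by move=> da dV; rewrite /along_diff componentsZ; exact: mdiff_scale. Qed.

Lemma along_diff_0 p : along_diff p (fun=> 0).
Proof.
rewrite /along_diff (_ : components p _ = fun=> 0); first exact: mdiff_cst.
by apply/funext => q; exact: coord0.
Qed.

Lemma along_diff_sum p (I : Type) (s : seq I) (V : I -> M -> 'rV[R]_n) :
  (forall i, along_diff p (V i)) -> along_diff p (fun q => \sum_(i <- s) V i q).
Proof.
move=> dV; elim: s => [|i s IH].
  by under eq_fun do rewrite big_nil; exact: along_diff_0.
by under eq_fun do rewrite big_cons; exact: along_diff_add.
Qed.

Lemma along_diff_comp p (Y : vfield N) :
  field_at (chart_at (F p)) (F p) Y -> along_diff p (fun q => Y (F q)).
Proof.
move=> fY; apply: is_dfun_mdiff.
exact: (dfun_comp (chart_at_atlas (F p)) (chart_at_dom (F p)) fY).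
Qed.

Lemma along_diff_push p (X : vfield M) : field_at (chart_at p) p X ->
  along_diff p (fun q => dmap F q (X q)).
Proof.
move=> fX; set e := chart_at (F p).
have ae : atlas e by exact: chart_at_atlas.
have ep : cdom e (F p) by exact: chart_at_dom.
apply: (mdiff_near (f := fun q => dfun q (cmap e \o F) (X q))).
  by apply: filterS (near_map_dom ep) => q eFq; rewrite /components coord_dmap.
apply: smooth_at_mdiff; apply: smooth_at_dfun => //.
- exact: chart_at_atlas.
- exact: chart_at_dom.
- apply: smooth_at_map => //; [exact: chart_at_atlas|exact: chart_at_dom].
Qed.

(** [V] and [W] exist only along [F], so smoothness of the metric applies not to
    them but to the coefficients of the metric in the coordinate fields, in terms
    of which the pairing is bilinear. *)
Lemma mdiff_metric (g : metric N) p V W : along_diff p V -> along_diff p W ->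
  mdiff p (fun q => g (F q) (V q) (W q) : R^o).
Proof.
move=> dV dW; set e := chart_at (F p).
have ae : atlas e by exact: chart_at_atlas.
have ep : cdom e (F p) by exact: chart_at_dom.
pose G i j r : R^o := g r (frame e i r) (frame e j r).
have dG i j : mdiff p (fun q => G i j (F q)).
  apply: is_dfun_mdiff; apply: (dfun_comp ae ep).
  have oe : open (cdom e) by exact: cdom_open.
  have := metric_smooth g oe (smooth_field_frame i ae) (smooth_field_frame j ae).
  by move/smooth_funP => /(_ oe)/(_ _ ep).
apply: (mdiff_near (f := fun q => \sum_(i < n) (components p V q 0 i : R^o) *:
   \sum_(j < n) (components p W q 0 j : R^o) *: G i j (F q))).
  apply: filterS2 (along_expand p V) (along_expand p W) => q Vq Wq.
  rewrite [in RHS]Vq [in RHS]Wq metric_sym metric_sumr; apply: eq_bigr => i _.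
  rewrite metricZr; congr (_ * _); rewrite metric_sym metric_sumr; apply: eq_bigr => j _.
  by rewrite metricZr.
apply: mdiff_sum => i; apply: mdiff_scale.
  exact: is_dfun_mdiff (mdiff_entry i dV).
apply: mdiff_sum => j; apply: mdiff_scale => //.
exact: is_dfun_mdiff (mdiff_entry j dW).
Qed.

Context (D : connection N).

(** The coordinate fields of [chart_at (F p)] form the canonical basis of the
    tangent space at [F p], so that the derivative terms add up to the derivative
    of the row of components. *)
Lemma cov_alongE p u V : cov_along D F p u V =
  dfun p (components p V) u
  + \sum_(i < n) V p 0 i *: D (F p) (dmap F p u) (frame (chart_at (F p)) i).
Proof.
rewrite /cov_along big_split /=; congr (_ + _); last first.
  by apply: eq_bigr => i _; rewrite -/(components p V p) components_at.
rewrite {2}(row_sum_delta (dfun p (components p V) u)); apply: eq_bigr => i _.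
congr (_ *: _); rewrite -(coord_chart_at (F p) (frame _ _ _)) coord_frame_id //.
  exact: chart_at_atlas.
exact: chart_at_dom.
Qed.

Lemma cov_along_near p u V W : (\forall q \near p, V q = W q) ->
  along_diff p V -> cov_along D F p u V = cov_along D F p u W.
Proof.
move=> VW dV; have VWp : V p = W p by exact: (nbhs_singleton VW).
have dE : dfun p (components p V) u = dfun p (components p W) u.
  apply: dfun_near => //.
  by apply: filterS VW => q VWq; rewrite /components VWq.
by rewrite (cov_alongE p u V) (cov_alongE p u W) VWp dE.
Qed.

Lemma cov_along_add p u V W : along_diff p V -> along_diff p W ->
  cov_along D F p u (fun q => V q + W q) = cov_along D F p u V + cov_along D F p u W.
Proof.
move=> /mdiffP dV /mdiffP dW; rewrite !cov_alongE componentsD.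
rewrite (is_dfunE u (is_dfun_add dV dW)) addrACA; congr (_ + _).
by rewrite -big_split /=; apply: eq_bigr => i _; rewrite mxE scalerDl.
Qed.

Lemma cov_along_scale p u (a : M -> R^o) V : mdiff p a -> along_diff p V ->
  cov_along D F p u (fun q => a q *: V q) =
  dfun p a u *: V p + a p *: cov_along D F p u V.
Proof.
move=> /mdiffP da /mdiffP dV; rewrite !cov_alongE componentsZ.
rewrite (is_dfunE u (is_dfun_scale da dV)) components_at scalerDr.
rewrite addrA [X in _ = X + _]addrC; congr (_ + _).
by rewrite scaler_sumr; apply: eq_bigr => i _; rewrite mxE scalerA.
Qed.

Lemma cov_along_0 p u : cov_along D F p u (fun=> 0) = 0.
Proof.
rewrite cov_alongE big1 => [|i _]; last by rewrite mxE scale0r.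
rewrite addr0 (_ : components p _ = fun=> 0); first exact: is_dfunE (is_dfun_cst _ _).
by apply/funext => q; exact: coord0.
Qed.

Lemma cov_along_sum p u (I : Type) (s : seq I) (V : I -> M -> 'rV[R]_n) :
  (forall i, along_diff p (V i)) ->
  cov_along D F p u (fun q => \sum_(i <- s) V i q)
  = \sum_(i <- s) cov_along D F p u (V i).
Proof.
move=> dV; elim: s => [|i s IH].
  by under eq_fun do rewrite big_nil; rewrite cov_along_0 big_nil.
under eq_fun do rewrite big_cons; rewrite big_cons cov_along_add ?IH //.
exact: along_diff_sum.
Qed.

(** Both sides have the same expansion in the coordinate fields, by the chain
    rule for the components of [Y]. *)
Lemma cov_along_comp p u (Y : vfield N) :
  smooth_field (cdom (chart_at (F p))) Y ->
  cov_along D F p u (fun q => Y (F q)) = D (F p) (dmap F p u) Y.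
Proof.
move=> sY; set e := chart_at (F p).
have ae : atlas e by exact: chart_at_atlas.
have ep : cdom e (F p) by exact: chart_at_dom.
have fY : field_at e (F p) Y.
  by move/smooth_fieldP: sY; apply => //; exact: cdom_open.
rewrite cov_alongE (connection_frame D _ ae ep sY) big_split /=; congr (_ + _); last first.
  by apply: eq_bigr => i _; rewrite coord_chart_at.
rewrite (is_dfunE u (dfun_comp ae ep fY)).
rewrite [LHS](row_sum_delta _); apply: eq_bigr => i _.
have d1 : mdiff (F p) (fun r => coord e r (Y r)) by exact: smooth_at_mdiff.
rewrite (is_dfunE _ (mdiff_entry i d1)); congr (_ *: _).
by rewrite -(coord_chart_at (F p) (frame _ _ _)) coord_frame_id.
Qed.

(** The derivative terms differ by the bracket, by naturality applied to [F]
    read in a chart.  The Christoffel terms cancel, the coordinate fields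
    having bracket 0. *)
Lemma cov_along_torsion (g : metric N) p (X Y : vfield M) : levi_civita g D ->
  field_at (chart_at p) p X -> field_at (chart_at p) p Y ->
  cov_along D F p (X p) (fun q => dmap F q (Y q))
  - cov_along D F p (Y p) (fun q => dmap F q (X q)) = dmap F p (bracket X Y p).
Proof.
move=> [tD _] fX fY; set e := chart_at (F p).
have ae : atlas e by exact: chart_at_atlas.
have ep : cdom e (F p) by exact: chart_at_dom.
have ac := chart_at_atlas p; have cp := chart_at_dom p.
have oe : open (cdom e) by exact: cdom_open.
have sf i : smooth_field (cdom e) (frame e i) by exact: smooth_field_frame.
have sG := smooth_at_map ac ae cp ep.
have componentsE Z u : field_at (chart_at p) p Z ->
    dfun p (components p (fun q => dmap F q (Z q))) u =
    dfun p (fun q => dfun q (cmap e \o F) (Z q)) u.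
  move=> fZ; apply: dfun_near; last exact: along_diff_push.
  by apply: filterS (near_map_dom ep) => q eFq; rewrite /components coord_dmap.
have symD i j : D (F p) (frame e i (F p)) (frame e j)
              = D (F p) (frame e j (F p)) (frame e i).
  apply/eqP; rewrite -subr_eq0 (tD _ _ _ _ oe (sf i) (sf j) ep) /bracket.
  have b0 l w : dfun (F p) (fun r : N => coord e r (frame e l r)) w = 0.
    have h : \forall r \near F p, delta_mx 0 l = coord e r (frame e l r).
      by apply: filterS (near_cdom ep) => r er; rewrite coord_frame_id.
    exact: is_dfunE w (near_eq_is_dfun h (is_dfun_cst _ _)).
  by rewrite !b0 subrr.
have De u i : D (F p) (dmap F p u) (frame e i)
    = \sum_(j < n) dmap F p u 0 j *: D (F p) (frame e j (F p)) (frame e i).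
  have lD := connection_linear D oe (sf i) ep.
  pose lM := GRing.isLinear.Build _ _ _ _ _ lD.
  pose L : {linear 'rV[R]_n -> 'rV[R]_n} := HB.pack (fun w => D (F p) w (frame e i)) lM.
  have := linear_deltaE L (dmap F p u); rewrite /= => ->.
  apply: eq_bigr => j _; congr (_ *: D _ _ _).
  by rewrite -(coord_chart_at (F p) (frame _ _ _)) coord_frame_id.
rewrite !cov_alongE (componentsE Y (X p) fY) (componentsE X (Y p) fX) opprD addrACA.
rewrite -[RHS]/(dfun p (cmap e \o F) (bracket X Y p)) dfun_bracket //.
rewrite -[RHS]addr0; congr (_ + _); apply/eqP; rewrite subr_eq0; apply/eqP.
under eq_bigr do rewrite De scaler_sumr.
under [RHS]eq_bigr do rewrite De scaler_sumr.
rewrite exchange_big /=; apply: eq_bigr => i _; apply: eq_bigr => j _.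
by rewrite symD !scalerA mulrC.
Qed.

End Along.

(** * Sasakian structures *)

Section SasakianAlgebra.
Context {R : realType} {m : nat} {N : manifold R m.*2.+1} (S : sasakian N).
Implicit Types (r : N).
Local Notation g := (sg S).
Local Notation phi := (sphi S).
Local Notation eta := (seta S).
Local Notation xi := (sxi S).

Lemma phi0 r : phi r 0 = 0.
Proof.
have := sphi_linear S r (-1) 0 0.
by rewrite scaler0 addr0 scaleN1r addNr.
Qed.

Lemma phiZ r a u : phi r (a *: u) = a *: phi r u.
Proof. by have := sphi_linear S r a u 0; rewrite !addr0 phi0 addr0. Qed.

Lemma phiD r u v : phi r (u + v) = phi r u + phi r v.
Proof. by have := sphi_linear S r 1 u v; rewrite !scale1r. Qed.

Lemma phiB r u v : phi r (u - v) = phi r u - phi r v.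
Proof. by rewrite phiD -scaleN1r phiZ scaleN1r. Qed.

Lemma phi_sum r (I : Type) (s : seq I) (f : I -> 'rV[R]_(m.*2.+1)) :
  phi r (\sum_(j <- s) f j) = \sum_(j <- s) phi r (f j).
Proof.
by elim: s => [|j s IH]; rewrite ?big_nil ?phi0 // !big_cons phiD IH.
Qed.

(** Apply [sg_phi] to [u] and [xi]: the left-hand side vanishes, as [phi]
    kills [xi]. *)
Lemma eta_metric r u : eta r u = g r u (xi r).
Proof.
have := sg_phi S r u (xi r); rewrite sphi_xi metric0r seta_xi mulr1.
by move/esym/eqP; rewrite subr_eq0 => /eqP.
Qed.

(** Compare the two ways of computing the cube of [phi]. *)
Lemma eta_phi r u : eta r (phi r u) = 0.
Proof.
have h := sphi_sqr S r (phi r u).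
have h' : phi r (phi r (phi r u)) = - phi r u.
  by rewrite (sphi_sqr S r u) phiD phiZ sphi_xi scaler0 addr0 -scaleN1r phiZ scaleN1r.
rewrite h' in h; have : eta r (phi r u) *: xi r = 0.
  by apply: (addrI (- phi r u)); rewrite addr0.
move=> /(congr1 (eta r)); rewrite !eta_metric metricZl metric0l -!eta_metric.
by rewrite seta_xi mulr1.
Qed.

(** Apply [sg_phi] to [u] and [phi v]. *)
Lemma metric_phi_skew r u v : g r (phi r u) v = - g r u (phi r v).
Proof.
have := sg_phi S r u (phi r v); rewrite eta_phi mulr0 subr0 => <-.
rewrite sphi_sqr metricDr metricNr metricZr opprD opprK.
by rewrite -eta_metric eta_phi mulr0 subr0.
Qed.

Context {k : nat} {M : manifold R k} (F : M -> N) (sF : smooth_map F).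

Lemma along_phi_expand p (V : M -> 'rV[R]_(m.*2.+1)) : \forall q \near p,
  phi (F q) (V q) = \sum_(j < m.*2.+1) (components F p V q 0 j : R^o) *:
     phi (F q) (frame (chart_at (F p)) j (F q)).
Proof.
apply: filterS (along_expand sF p V) => q Vq.
by rewrite {1}Vq phi_sum; apply: eq_bigr => j _; rewrite phiZ.
Qed.

Lemma smooth_field_phi_frame p j :
  smooth_field (cdom (chart_at (F p)))
    (fun r => phi r (frame (chart_at (F p)) j r)).
Proof.
apply: sphi_smooth; first exact: cdom_open.
by apply: smooth_field_frame; exact: chart_at_atlas.
Qed.

Lemma along_diff_phi_frame p j :
  along_diff F p (fun q => phi (F q) (frame (chart_at (F p)) j (F q))).
Proof.
apply: (along_diff_comp sF (Y := fun r => phi r (frame _ j r))).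
have oe : open (cdom (chart_at (F p))) by exact: cdom_open.
move/smooth_fieldP: (smooth_field_phi_frame p j) => /(_ oe); apply.
exact: chart_at_dom.
Qed.

Lemma along_diff_frame p j :
  along_diff F p (fun q => frame (chart_at (F p)) j (F q)).
Proof.
apply: (along_diff_comp sF); apply: field_at_frame.
  exact: chart_at_atlas.
exact: chart_at_dom.
Qed.

Lemma mdiff_components_entry p (V : M -> 'rV[R]_(m.*2.+1)) j : along_diff F p V ->
  mdiff p (fun q => components F p V q 0 j : R^o).
Proof. by move=> dV; exact: is_dfun_mdiff (mdiff_entry j dV). Qed.

Lemma along_diff_phi p (V : M -> 'rV[R]_(m.*2.+1)) : along_diff F p V ->
  along_diff F p (fun q => phi (F q) (V q)).
Proof.
move=> dV.
apply: (along_diff_near (V := fun q => \sum_(j < m.*2.+1) (components F p V q 0 j : R^o) *: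
     phi (F q) (frame (chart_at (F p)) j (F q)))).
  by apply: filterS (along_phi_expand p V) => q ->.
apply: along_diff_sum => j; apply: along_diff_scale.
  exact: mdiff_components_entry.
exact: along_diff_phi_frame.
Qed.

(** The equation for the covariant derivative of [phi], transported to fields
    along [F]: it is tensorial, so it suffices to know it for the coordinate
    fields, which do extend to the ambient manifold. *)
Lemma cov_along_phi p u (V : M -> 'rV[R]_(m.*2.+1)) : along_diff F p V ->
  cov_along (snabla S) F p u (fun q => phi (F q) (V q)) =
  phi (F p) (cov_along (snabla S) F p u V)
  + (g (F p) (dmap F p u) (V p) *: xi (F p) - eta (F p) (V p) *: dmap F p u).
Proof.
move=> dV; set e := chart_at (F p); set w := dmap F p u.
have ae : atlas e by exact: chart_at_atlas.
have ep : cdom e (F p) by exact: chart_at_dom.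
have oe : open (cdom e) by exact: cdom_open.
have sf j : smooth_field (cdom e) (frame e j) by exact: smooth_field_frame.
have dj j := mdiff_components_entry j dV.
have VE : cov_along (snabla S) F p u V = \sum_(j < m.*2.+1)
   (dfun p (fun q => components F p V q 0 j : R^o) u *: frame e j (F p)
    + V p 0 j *: snabla S (F p) w (frame e j)).
  rewrite (cov_along_near _ _ (along_expand sF p V) dV).
  rewrite cov_along_sum => [|j]; last first.
    by apply: along_diff_scale => //; exact: along_diff_frame.
  apply: eq_bigr => j _.
  rewrite (cov_along_scale _ _ (dj j) (along_diff_frame p j)).
  by rewrite (cov_along_comp sF) // components_at.
have PE : cov_along (snabla S) F p u (fun q => phi (F q) (V q)) = \sum_(j < m.*2.+1)
   (dfun p (fun q => components F p V q 0 j : R^o) u *: phi (F p) (frame e j (F p))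
    + V p 0 j *: snabla S (F p) w (fun r => phi r (frame e j r))).
  rewrite (cov_along_near _ _ (along_phi_expand p V) (along_diff_phi dV)).
  rewrite cov_along_sum => [|j]; last first.
    by apply: along_diff_scale => //; exact: along_diff_phi_frame.
  apply: eq_bigr => j _.
  rewrite (cov_along_scale _ _ (dj j) (along_diff_phi_frame p j)).
  rewrite (cov_along_comp sF _ _ (Y := fun r => phi r (frame e j r))) ?components_at //.
  exact: smooth_field_phi_frame.
have Vp : V p = \sum_(j < m.*2.+1) V p 0 j *: frame e j (F p).
  by rewrite {1}(frame_expand (V p) ae ep) coord_chart_at.
have gV : g (F p) w (V p) = \sum_(j < m.*2.+1) V p 0 j * g (F p) w (frame e j (F p)).
  by rewrite {1}Vp metric_sumr; apply: eq_bigr => j _; rewrite metricZr.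
have etaV : eta (F p) (V p) = \sum_(j < m.*2.+1) V p 0 j * eta (F p) (frame e j (F p)).
  rewrite eta_metric metric_sym {1}Vp metric_sumr; apply: eq_bigr => j _.
  by rewrite metricZr eta_metric metric_sym.
rewrite PE VE gV etaV phi_sum !scaler_suml -sumrB -big_split /=.
apply: eq_bigr => j _; rewrite phiD !phiZ -!scalerA -scalerBr -addrA -scalerDr.
congr (_ + _ *: _).
by rewrite -(snabla_phi S w oe (sf j) ep) addrC subrK.
Qed.

End SasakianAlgebra.

(** * Differentiability of inverse matrices *)

Section MdiffMatrix.
Context {R : realType} {n : nat} {M : manifold R n}.
Implicit Types (p q : M).

Lemma mdiff_mul p (a b : M -> R^o) :
  mdiff p a -> mdiff p b -> mdiff p (fun q => a q * b q : R^o).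
Proof. exact: mdiff_scale. Qed.

Lemma mdiff_prod p (I : Type) (s : seq I) (a : I -> M -> R^o) :
  (forall i, mdiff p (a i)) -> mdiff p (fun q => \prod_(i <- s) a i q : R^o).
Proof.
move=> da; elim: s => [|i s IH].
  by under eq_fun do rewrite big_nil; exact: mdiff_cst.
by under eq_fun do rewrite big_cons; exact: mdiff_mul.
Qed.

Lemma mdiff_det p d (A : M -> 'M[R]_d) :
  (forall i j, mdiff p (fun q => A q i j : R^o)) -> mdiff p (fun q => \det (A q) : R^o).
Proof.
move=> dA; apply: mdiff_sum => s; apply: mdiff_mul; first exact: mdiff_cst.
by apply: mdiff_prod => i; exact: dA.
Qed.

Lemma mdiff_inv p (a : M -> R^o) : a p != 0 -> mdiff p a ->
  mdiff p (fun q => (a q)^-1 : R^o).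
Proof.
move=> ap da; apply: (differentiableV (f := a \o cinv (chart_at p))) => //=.
by rewrite cmapK //; exact: chart_at_dom.
Qed.

(** By Cramer's rule, the entries of the inverse are quotients of polynomials
    in those of [A]. *)
Lemma mdiff_invmx p d (A : M -> 'M[R]_d) i j :
  (\forall q \near p, A q \in unitmx) ->
  (forall i j, mdiff p (fun q => A q i j : R^o)) ->
  mdiff p (fun q => invmx (A q) i j : R^o).
Proof.
move=> uA dA.
apply: (mdiff_near (f := fun q => (\det (A q))^-1 * cofactor (A q) j i : R^o)).
  by apply: filterS uA => q uq; rewrite /invmx uq !mxE.
apply: mdiff_mul.
  apply: mdiff_inv; last exact: mdiff_det.
  by have := nbhs_singleton uA; rewrite unitmxE unitfE.
apply: mdiff_mul; first exact: mdiff_cst.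
apply: mdiff_det => a b.
by under eq_fun do rewrite !mxE; exact: dA.
Qed.

End MdiffMatrix.

(** * PTR-submanifolds *)

Section Submanifold.
Context {R : realType} {m k : nat} {N : manifold R m.*2.+1} {S : sasakian N}
  {M : manifold R k} (i : ptr_submanifold S M).
Implicit Types (p q : M) (X Y Z : vfield M).
Local Notation g := (sg S).
Local Notation phi := (sphi S).
Local Notation eta := (seta S).
Local Notation xi := (sxi S).
Local Notation nab := (cov_along (snabla S) i).

Let sF : smooth_map i := (ptr_immersion i).1.

Lemma dmap_eq0 p u : dmap i p u = 0 -> u = 0.
Proof.
move=> u0; apply: ((ptr_immersion i).2 p).
by rewrite u0 /dmap /dfun linear0.
Qed.

Definition gram (c : chart R k M) q : 'M[R]_k := \matrix_(a, b)
  g (i q) (dmap i q (frame c a q)) (dmap i q (frame c b q)).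

(** A kernel vector of the Gram matrix is a tangent vector whose image is
    orthogonal to itself; the metric is definite and [i] an immersion. *)
Lemma gram_unit c q : atlas c -> cdom c q -> gram c q \in unitmx.
Proof.
move=> ac cq; rewrite -row_free_unit; apply: inj_row_free => x xG.
have [u uE] : exists u, u = \sum_(a < k) x 0 a *: frame c a q by eexists.
have ub b : g (i q) (dmap i q u) (dmap i q (frame c b q)) = 0.
  rewrite metric_sym uE dmap_sum metric_sumr.
  have xGb : \sum_a x 0 a * gram c q a b = 0.
    by have /rowP/(_ b) := xG; rewrite !mxE.
  apply: etrans xGb; apply: eq_bigr => a _.
  by rewrite dmapZ metricZr mxE metric_sym.
have u0 : u = 0.
  apply: (@dmap_eq0 q); apply: (@metric_eq0 _ _ _ g (i q)).
  rewrite {2}uE dmap_sum metric_sumr big1 // => b _.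
  by rewrite dmapZ metricZr ub mulr0.
apply/rowP => b; rewrite mxE.
have : coord c q u 0 b = 0 by rewrite u0 coord0 mxE.
have -> : coord c q u = \sum_(a < k) x 0 a *: coord c q (frame c a q).
  by rewrite uE /coord /dfun linear_sum; apply: eq_bigr => a _; rewrite linearZ.
under eq_bigr do rewrite coord_frame_id //.
by rewrite -row_sum_delta.
Qed.

(** The coefficients, in the coordinate fields of [c], of the tangential part
    of [w], obtained by solving the Gram system. *)
Definition tangent_coef (c : chart R k M) q (w : 'rV[R]_(m.*2.+1)) : 'rV[R]_k :=
  (\row_b g (i q) w (dmap i q (frame c b q))) *m invmx (gram c q).

Lemma tangent_coefP c q w : atlas c -> cdom c q ->
  forall v, g (i q) (w - dmap i q (\sum_(a < k) tangent_coef c q w 0 a *: frame c a q))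
                 (dmap i q v) = 0.
Proof.
move=> ac cq v.
have [u uE] : exists u, u = \sum_(a < k) tangent_coef c q w 0 a *: frame c a q by eexists.
rewrite -uE {1}(frame_expand v ac cq) dmap_sum metric_sumr big1 // => b _.
rewrite dmapZ metricZr metricBl.
suff -> : g (i q) (dmap i q u) (dmap i q (frame c b q)) = g (i q) w (dmap i q (frame c b q)).
  by rewrite subrr mulr0.
have : tangent_coef c q w *m gram c q = \row_b g (i q) w (dmap i q (frame c b q)).
  by rewrite /tangent_coef mulmxKV // gram_unit.
move: (tangent_coef c q w) uE => x uE /rowP/(_ b); rewrite !mxE => <-.
rewrite uE metric_sym dmap_sum metric_sumr; apply: eq_bigr => a _.
by rewrite dmapZ metricZr mxE metric_sym.
Qed.

Lemma tangent_partP p w v : g (i p) (w - dmap i p (tangent_part i p w)) (dmap i p v) = 0.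
Proof.
have h := tangent_coefP w (chart_at_atlas p) (chart_at_dom p).
exact: (@xgetPex _ 0 [set u | forall v, g (i p) (w - dmap i p u) (dmap i p v) = 0]
  (ex_intro _ _ h)).
Qed.

Lemma tangent_part_unique p w u :
  (forall v, g (i p) (w - dmap i p u) (dmap i p v) = 0) -> tangent_part i p w = u.
Proof.
move=> hu; apply/eqP; rewrite -subr_eq0; apply/eqP/(@dmap_eq0 p).
apply: (@metric_eq0 _ _ _ g (i p)).
have h1 := tangent_partP p w (tangent_part i p w - u).
have h2 := hu (tangent_part i p w - u).
rewrite {1}dmapB metricBl.
move/eqP: h1; rewrite metricBl subr_eq0 => /eqP <-.
by move/eqP: h2; rewrite metricBl subr_eq0 => /eqP <-; rewrite subrr.
Qed.

Lemma metric_tangent p w v :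
  g (i p) (dmap i p (tangent_part i p w)) (dmap i p v) = g (i p) w (dmap i p v).
Proof.
have := tangent_partP p w v; rewrite metricBl => /eqP.
by rewrite subr_eq0 eq_sym => /eqP.
Qed.

Lemma metric_normal p w z : (forall v, g (i p) z (dmap i p v) = 0) ->
  g (i p) (normal_part i p w) z = g (i p) w z.
Proof.
by move=> hz; rewrite /normal_part metricBl [X in _ - X]metric_sym hz subr0.
Qed.

(** Cramer's rule for the Gram matrix expresses the coefficients of the
    tangential part by differentiable functions. *)
Lemma along_diff_tangent p (W : M -> 'rV[R]_(m.*2.+1)) : along_diff i p W ->
  along_diff i p (fun q => dmap i q (tangent_part i q (W q))).
Proof.
move=> dW; set c := chart_at p.
have ac : atlas c by exact: chart_at_atlas.
have cp : cdom c p by exact: chart_at_dom.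
have de a : along_diff i p (fun q => dmap i q (frame c a q)).
  by apply: along_diff_push => //; exact: field_at_frame.
apply: (along_diff_near (V := fun q => \sum_(a < k)
    (tangent_coef c q (W q) 0 a : R^o) *: dmap i q (frame c a q))).
  apply: filterS (near_cdom cp) => q cq.
  rewrite (tangent_part_unique (tangent_coefP (W q) ac cq)) dmap_sum.
  by apply: eq_bigr => a _; rewrite dmapZ.
apply: along_diff_sum => a; apply: along_diff_scale (de a).
under eq_fun do rewrite mxE.
apply: mdiff_sum => b; apply: mdiff_mul.
  by under eq_fun do rewrite mxE; exact: mdiff_metric.
apply: mdiff_invmx.
  by apply: filterS (near_cdom cp) => q cq; exact: gram_unit.
by move=> a' b'; under eq_fun do rewrite mxE; exact: mdiff_metric.
Qed.

Lemma section_field_at (E : distribution M) X p : section E X ->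
  field_at (chart_at p) p X.
Proof. by move=> [sX _]; move/smooth_fieldP: sX; apply => //; exact: openT. Qed.

Lemma along_diff_section (E : distribution M) X p : section E X ->
  along_diff i p (push i X).
Proof. by move=> sX; apply: along_diff_push => //; exact: section_field_at sX. Qed.

Lemma eta_ambiguous p u : ambiguous i p u -> eta (i p) (dmap i p u) = 0.
Proof.
move=> /(_ (ptr_xi i p)) h; rewrite eta_metric -ptr_xiE; apply: h.
by apply: (subvP (addvSr _ _)); exact: memv_line.
Qed.

(** For fields orthogonal to the Reeb field, applying the structure equation
    to [phi (phi Y) = - Y] computes the Reeb component of a derivative. *)
Lemma eta_cov_ambiguous X Y p : section (ambiguous i) Y ->
  eta (i p) (nab p (X p) (push i Y)) = g (i p) (phi (i p) (push i X p)) (push i Y p).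
Proof.
move=> sY; have dY := along_diff_section p sY.
have dphiY := along_diff_phi S sF dY.
have := cov_along_phi S sF (X p) dphiY.
have -> : (fun q => phi (i q) (phi (i q) (push i Y q))) = (fun q => -1 *: push i Y q).
  apply/funext => q; rewrite sphi_sqr (eta_ambiguous (sY.2 q)) scale0r addr0.
  by rewrite scaleN1r.
rewrite (cov_along_scale _ _ (mdiff_cst p (-1 : R^o)) dY).
rewrite (is_dfunE _ (is_dfun_cst p (-1 : R^o))) scale0r add0r scaleN1r.
rewrite eta_phi scale0r subr0 => /(congr1 (eta (i p))).
rewrite !eta_metric metric_sym metricNr metric_sym -eta_metric.
rewrite metricDl metricZl -!eta_metric eta_phi add0r seta_xi mulr1 => E.
by rewrite metric_phi_skew -E opprK.
Qed.

(** By skew-symmetry of [phi], the derivative of [Y] along [X] and that of [X]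
    along [Y] have opposite Reeb components. *)
Lemma eta_bracket X Y p : section (ambiguous i) X -> section (ambiguous i) Y ->
  eta (i p) (dmap i p (bracket X Y p))
  = 2%:R * g (i p) (push i (phi_tan i X) p) (push i Y p).
Proof.
move=> sX sY.
rewrite -(cov_along_torsion sF (snabla_levi_civita S)
  (section_field_at p sX) (section_field_at p sY)).
rewrite eta_metric metricBl -!eta_metric !eta_cov_ambiguous // metric_tangent.
by rewrite [X in _ - X]metric_phi_skew opprK [X in _ + X]metric_sym mulr_natl mulr2n.
Qed.

(** The normal vector [phi Z] does not distinguish a vector from its normal
    part, so the terms in [phi_tan] and [phi_nor] recombine into the derivatives
    of [phi X] and [phi Y]; the metric and [eta] terms of [cov_along_phi] then
    drop out because [eta] vanishes on [X], [Y], [Z] and on the image of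
    [phi]. *)
Lemma metric_Qtensor X Y Z p : section (ambiguous i) X -> section (ambiguous i) Y ->
  section (totally_real i) Z ->
  g (i p) (Qtensor i X Y p) (phi (i p) (push i Z p))
  = g (i p) (dmap i p (bracket X Y p)) (push i Z p).
Proof.
move=> sX sY sZ; set z := phi (i p) (push i Z p).
have hz v : g (i p) z (dmap i p v) = 0 by exact: (ptr_D_phi v (sZ.2 p)).
have cov_phi A B : section (ambiguous i) B ->
    g (i p) (second_form i A (phi_tan i B) p) z + g (i p) (normal_cov i A (phi_nor i B) p) z
    = g (i p) (nab p (A p) (fun q => phi (i q) (push i B q))) z.
  move=> sB; rewrite !metric_normal // -metricDl.
  have dphi := along_diff_phi S sF (along_diff_section p sB).
  have dtan := along_diff_tangent dphi.
  have dnor : along_diff i p (phi_nor i B).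
    have := along_diff_add dphi (along_diff_scale (mdiff_cst p (-1 : R^o)) dtan).
    by congr (along_diff i p _); apply/funext => q; rewrite scaleN1r.
  rewrite -(cov_along_add _ _ dtan dnor); congr (g _ (nab p _ _) _).
  by apply/funext => q; rewrite /phi_nor /normal_part addrC subrK.
have Qz A B : section (ambiguous i) B ->
    g (i p) (nab p (A p) (fun q => phi (i q) (push i B q))) z
    = g (i p) (phi (i p) (nab p (A p) (push i B))) z.
  move=> sB; rewrite (cov_along_phi S sF _ (along_diff_section p sB)).
  rewrite (eta_ambiguous (sB.2 p)) scale0r subr0 metricDl metricZl.
  by rewrite [X in _ + _ * X]metric_sym -eta_metric eta_phi mulr0 addr0.
rewrite /Qtensor metricBl metricDl metricBl.
have aux (a b c d : R) : a - b + c - d = (a + c) - (b + d) by ring.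
rewrite aux !cov_phi // !Qz // -metricBl -phiB.
rewrite (cov_along_torsion sF (snabla_levi_civita S)
  (section_field_at p sX) (section_field_at p sY)).
by rewrite sg_phi (ptr_D_eta (sZ.2 p)) mulr0 subr0.
Qed.

(** Test the bracket against the Reeb field and against the value at [p] of a
    global section of the totally real distribution. *)
Lemma ambiguous_bracketP X Y p : section (ambiguous i) X -> section (ambiguous i) Y ->
  (forall Z, section (totally_real i) Z ->
     g (i p) (Qtensor i X Y p) (phi (i p) (push i Z p)) = 0) ->
  g (i p) (push i (phi_tan i X) p) (push i Y p) = 0 ->
  ambiguous i p (bracket X Y p).
Proof.
move=> sX sY hQ hP _ /memv_addP[v vD [_ /vlineP[a ->] ->]].
rewrite (dmapD _ _ v) metricDr dmapZ metricZr ptr_xiE -eta_metric eta_bracket // hP.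
rewrite !mulr0 addr0.
have [Z [sZ Zp]] := section_through (@ptr_D_smooth _ _ _ _ _ _ i) vD.
have := metric_Qtensor p sX sY sZ; rewrite hQ // => /esym.
by rewrite /push Zp.
Qed.

End Submanifold.

Theorem proposition4p2 (R : realType) (m k : nat) (N : manifold R m.*2.+1)
    (S : sasakian N) (M : manifold R k) (i : ptr_submanifold S M) :
  integrable_distribution (ambiguous i) <->
  (forall X Y : vfield M, section (ambiguous i) X -> section (ambiguous i) Y ->
     (forall Z : vfield M, section (totally_real i) Z ->
        forall p : M, sg S (i p) (Qtensor i X Y p)
                           (sphi S (i p) (push i Z p)) = 0) /\
     (forall p : M, sg S (i p) (push i (phi_tan i X) p) (push i Y p) = 0)).
Proof.
split=> [int X Y sX sY|hyp X Y sX sY].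
  have [_ bD] := int X Y sX sY; split=> [Z sZ p|p].
    rewrite metric_Qtensor //; apply: (bD p).
    by apply: (subvP (addvSl _ _)); exact: sZ.2.
  have := eta_bracket p sX sY; rewrite (eta_ambiguous (bD p)) => /esym/eqP.
  by rewrite mulf_eq0 pnatr_eq0 => /eqP.
have [hQ hP] := hyp X Y sX sY; split.
  by apply: smooth_bracket; [exact: sX.1|exact: sY.1].
by move=> p; apply: ambiguous_bracketP => // Z sZ; exact: hQ.
Qed.
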